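(* Let $\lambda\in\mathbb{C}$ and $\mu>0$. Let $f \in \mathcal{S}_{\mathcal{AP}}^{*}$, $f(z)=z+\sum_{n=2}^{\infty}a_nz^n$, and let $F_{\lambda,\mu}(f)=|a_3-\lambda a_2^2|-\mu|a_2|$. Then $F_{\lambda,\mu}(f) \ge B_{\mathcal{AP}}(\lambda,\mu)$, where $$B_{\mathcal{AP}}(\lambda,\mu) = \begin{cases} \dfrac{9}{4} \left| \lambda - \dfrac{25}{36} \right| - \dfrac{3\mu}{2}, & \text{if } \left| \lambda - \dfrac{25}{36} \right| \le \dfrac{\mu - 1}{3}, \\[3mm] -\dfrac{3\mu}{2} \sqrt{ \dfrac{4}{12 \left| \lambda - \frac{25}{36} \right| + 4} }, & \text{if } \mu^2 \le 3 \left| \lambda - \dfrac{25}{36} \right| + 1, \\[4mm] -\dfrac{3}{4} - \dfrac{3\mu^2}{12 \left| \lambda - \frac{25}{36} \right| + 4}, & \text{otherwise}. \end{cases}$$ The estimates are best possible, i.e. for every such $\lambda,\mu$ there is a function in $\mathcal{S}_{\mathcal{AP}}^{*}$ for which equality holds.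
   Context: Let $\mathbb{D}=\{z\in\mathbb{C}:|z|<1\}$, and let $\mathcal{A}$ be the class of analytic functions $f$ on $\mathbb{D}$ normalized by $f(0)=0$, $f'(0)=1$, written $f(z)=z+\sum_{n=2}^{\infty}a_nz^n$. For analytic $f,g$ on $\mathbb{D}$, $f\prec g$ (subordination) means that there is an analytic function $\omega$ on $\mathbb{D}$ with $\omega(0)=0$ and $|\omega(z)|<1$ (a Schwarz function) such that $f(z)=g(\omega(z))$ for $z\in\mathbb{D}$. The class $\mathcal{S}_{\mathcal{AP}}^{*}$ consists of all $f\in\mathcal{A}$ with $$\frac{zf'(z)}{f(z)}\prec\psi_{\mathcal{AP}}(z):=e^{z}\sqrt{1+z},\quad z\in\mathbb{D},$$ where the square root is the principal branch (value $1$ at $z=0$). *)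

(* Defs.v *)
From Stdlib Require Import Reals Lra.
From Coquelicot Require Import Coquelicot.

Open Scope R_scope.

Definition unit_disk (z : C) : Prop := Cmod z < 1.

Definition analytic_on_disk (f : C -> C) : Prop :=
  forall z : C, unit_disk z -> ex_derive (K := C_AbsRing) (V := C_NormedModule) f z.

Definition class_A (f : C -> C) : Prop :=
  analytic_on_disk f /\ f (RtoC 0) = RtoC 0 /\ C_derive f (RtoC 0) = RtoC 1.

(* f(z) = z + sum_{n >= 2} a_n z^n on the unit disk; the entries a 0 and a 1
   play no role. *)
Definition has_coefficients (f : C -> C) (a : nat -> C) : Prop :=
  forall z : C, unit_disk z ->
    is_series (K := C_AbsRing) (V := C_NormedModule)
      (fun n : nat => (a (n + 2)%nat * z ^ (n + 2))%C) (f z - z)%C.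

Definition schwarz_function (w : C -> C) : Prop :=
  analytic_on_disk w /\ w (RtoC 0) = RtoC 0 /\
  forall z : C, unit_disk z -> Cmod (w z) < 1.

Definition subordinate (f g : C -> C) : Prop :=
  exists w : C -> C, schwarz_function w /\
    forall z : C, unit_disk z -> f z = g (w z).

Definition Cexp (z : C) : C :=
  (exp (Re z) * cos (Im z), exp (Re z) * sin (Im z)).

(* Principal branch: the square root with argument in (-PI/2, PI/2]. *)
Definition Csqrt (z : C) : C :=
  (sqrt ((Cmod z + Re z) / 2),
   (if Rlt_dec (Im z) 0 then -1 else 1) * sqrt ((Cmod z - Re z) / 2)).

Definition psi_AP (z : C) : C := (Cexp z * Csqrt (1 + z))%C.

(* z f'(z) / f(z), with its removable singularity at 0 filled in: the value
   there is 1 for every f in class_A.  Division by zero returns 0, a value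
   psi_AP omits on the disk (psi_AP_neq_0 below), so subordination to psi_AP
   forces f z <> 0 for 0 < |z| < 1. *)
Definition starlike_quotient (f : C -> C) (z : C) : C :=
  if Ceq_dec z (RtoC 0) then RtoC 1 else (z * C_derive f z / f z)%C.

Definition class_S_AP (f : C -> C) : Prop :=
  class_A f /\ subordinate (starlike_quotient f) psi_AP.

Definition F_functional (lambda : C) (mu : R) (a : nat -> C) : R :=
  Cmod (a 3%nat - lambda * a 2%nat ^ 2)%C - mu * Cmod (a 2%nat).

Definition B_AP (lambda : C) (mu : R) : R :=
  let d := Cmod (lambda - RtoC (25 / 36))%C in
  if Rle_dec d ((mu - 1) / 3) then 9 / 4 * d - 3 * mu / 2
  else if Rle_dec (mu ^ 2) (3 * d + 1) then
    - (3 * mu / 2) * sqrt (4 / (12 * d + 4))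
  else - (3 / 4) - 3 * mu ^ 2 / (12 * d + 4).

Lemma Csqrt_sqr (z : C) : (Csqrt z ^ 2)%C = z.
Proof.
destruct z as [x y].
assert (Hx := re_le_Cmod (x, y)). simpl Re in Hx.
assert (H1 : 0 <= (Cmod (x, y) + x) / 2) by (revert Hx; unfold Rabs; destruct Rcase_abs; lra).
assert (H2 : 0 <= (Cmod (x, y) - x) / 2) by (revert Hx; unfold Rabs; destruct Rcase_abs; lra).
assert (H3 : Cmod (x, y) ^ 2 = x ^ 2 + y ^ 2) by (rewrite Cmod2_alt; reflexivity).
assert (Hy : sqrt ((Cmod (x, y) + x) / 2) * sqrt ((Cmod (x, y) - x) / 2) = Rabs y / 2).
{ rewrite <- sqrt_mult by assumption.
  replace ((Cmod (x, y) + x) / 2 * ((Cmod (x, y) - x) / 2)) with (Rsqr (Rabs y / 2)).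
  - apply sqrt_Rsqr. assert (H := Rabs_pos y). lra.
  - unfold Rdiv. rewrite Rsqr_mult, <- Rsqr_abs. unfold Rsqr. nra. }
assert (S1 := sqrt_sqrt _ H1). assert (S2 := sqrt_sqrt _ H2).
unfold Csqrt. simpl Re; simpl Im.
set (p := sqrt ((Cmod (x, y) + x) / 2)) in *.
set (q := sqrt ((Cmod (x, y) - x) / 2)) in *.
unfold Cpow, Cmult. simpl.
destruct (Rlt_dec y 0) as [Hn | Hp].
- rewrite Rabs_left in Hy by assumption. f_equal; nra.
- rewrite Rabs_pos_eq in Hy by lra. f_equal; nra.
Qed.

Lemma Csqrt_re_nonneg (z : C) : 0 <= Re (Csqrt z).
Proof. apply sqrt_pos. Qed.

Lemma psi_AP_neq_0 (z : C) : unit_disk z -> psi_AP z <> RtoC 0.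
Proof.
intros Hz. apply Cmult_neq_0.
- intros H. assert (Hm : Cmod (Cexp z) ^ 2 = 0) by (rewrite H, Cmod_0; ring).
  rewrite Cmod2_alt in Hm. unfold Cexp in Hm. simpl in Hm.
  assert (He := exp_pos (Re z)). assert (Hsc := sin2_cos2 (Im z)).
  unfold Rsqr in Hsc. unfold Re, Im in *.
  assert (exp (fst z) * exp (fst z) * (sin (snd z) * sin (snd z) + cos (snd z) * cos (snd z)) = 0) by lra.
  rewrite Hsc in H0. nra.
- intros H. assert (H1 := Csqrt_sqr (1 + z)%C). rewrite H in H1.
  assert (Hz' : z = RtoC (-1)).
  { assert (E : (1 + z)%C = RtoC 0) by (rewrite <- H1; simpl; ring).
    replace z with ((1 + z) - 1)%C by ring. rewrite E. change (-1) with (- (1)). rewrite RtoC_opp. ring. }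
  unfold unit_disk in Hz. rewrite Hz', Cmod_R, Rabs_left in Hz; lra.
Qed.

(* Main.v *)
(* If w is a Schwarz function with z f'/f = psi_AP(w) and w(z) = c1 z + c2 z^2 + ..., then
   a_2 = (3/2) c1 and a_3 = (3/4) c2 + (25/16) c1^2, so that
   F = |(3/4) c2 - (9/4) (lambda - 25/36) c1^2| - (3/2) mu |c1|.  Since |c2| <= 1 - |c1|^2, the
   bound is the minimum of a function of |c1| in [0, 1], and it is attained for the functions
   w(z) = z (x + u z) / (1 + x u z) with x in [0, 1] and |u| = 1.

   The inequality |c2| <= 1 - |c1|^2 needs the maximum principle, obtained here without
   Cauchy's theory: psi_AP is locally univalent on the disk and f is a power series, so w has a
   second-order expansion at every point, and the second difference of |g|^2 + eps |z|^2 over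
   the four points z + i^k t rules out interior maxima.  The extremal f is built from power
   series solutions of y' = R y, first for y = psi_AP(w) and then for y = f(z)/z. *)

Require Import Defs.
From Stdlib Require Import Reals Lra Lia ClassicalEpsilon.
From Coquelicot Require Import Coquelicot.

Open Scope R_scope.

(** * Second-order expansions *)

(** Complex differentiability of w by itself yields only a first-order expansion. The working notion
    is therefore [taylor2]: a quadratic polynomial plus h^3 times a factor bounded near 0. Order two
    determines c2, and a third-order error is small against the second differences that detect a
    maximum. Products, reciprocals and composites preserve the notion, and so does inversion of a
    map with nonzero linear coefficient, which carries expansions from z f'/f to w. Division by z at
    the origin does not preserve it, so the maximum principle is stated for functions that are
    merely bounded at 0. For the extremal function, a series for psi_AP(w) obtained by substitution
    would require rearranging double series. A linear equation y' = R y needs only a coefficient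
    recursion and a Cauchy product, and a solution of y' = -R y serves as a reciprocal that settles
    uniqueness. R itself must then be an explicit series, which is why 1 + w is factored into linear
    terms. *)

Definition loc_bounded (r : C -> C) : Prop :=
  exists K d : R, 0 < d /\ forall h : C, Cmod h < d -> Cmod (r h) <= K.

Lemma lb_const (c : C) : loc_bounded (fun _ => c).
Proof. exists (Cmod c), 1; split; [lra | intros; lra]. Qed.

Lemma lb_id : loc_bounded (fun h => h).
Proof. exists 1, 1; split; [lra | intros; lra]. Qed.

Lemma lb_plus (f g : C -> C) :
  loc_bounded f -> loc_bounded g -> loc_bounded (fun h => f h + g h)%C.
Proof.
intros [K [d [Hd H]]] [K' [d' [Hd' H']]].
exists (K + K'), (Rmin d d'); split; [now apply Rmin_pos|].
intros h Hh. eapply Rle_trans; [apply Cmod_triangle|].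
apply Rplus_le_compat; [apply H | apply H'];
  (eapply Rlt_le_trans; [exact Hh|]); [apply Rmin_l | apply Rmin_r].
Qed.

Lemma lb_mult (f g : C -> C) :
  loc_bounded f -> loc_bounded g -> loc_bounded (fun h => f h * g h)%C.
Proof.
intros [K [d [Hd H]]] [K' [d' [Hd' H']]].
exists (K * K'), (Rmin d d'); split; [now apply Rmin_pos|].
intros h Hh. rewrite Cmod_mult.
apply Rmult_le_compat; try apply Cmod_ge_0; [apply H | apply H'];
  (eapply Rlt_le_trans; [exact Hh|]); [apply Rmin_l | apply Rmin_r].
Qed.

Lemma lb_opp (f : C -> C) : loc_bounded f -> loc_bounded (fun h => - f h)%C.
Proof.
intros [K [d [Hd H]]]. exists K, d; split; [exact Hd|].
intros h Hh. rewrite Cmod_opp. now apply H.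
Qed.

Lemma lb_minus (f g : C -> C) :
  loc_bounded f -> loc_bounded g -> loc_bounded (fun h => f h - g h)%C.
Proof. intros Hf Hg. apply lb_plus; [exact Hf | now apply lb_opp]. Qed.

Lemma lb_pow (f : C -> C) (n : nat) : loc_bounded f -> loc_bounded (fun h => f h ^ n)%C.
Proof.
intros Hf. induction n as [|n IH]; simpl; [apply lb_const | now apply lb_mult].
Qed.

(** This is the shape in which remainders of composites occur: an inner function moves by h times a
    bounded factor, and that increment ends up in the ball where r is bounded. *)
Lemma lb_comp (r s : C -> C) :
  loc_bounded r -> loc_bounded s -> loc_bounded (fun h => r (h * s h)%C).
Proof.
intros [K [d [Hd H]]] [K' [d' [Hd' H']]].
assert (HK : 0 < Rabs K' + 1) by (assert (T := Rabs_pos K'); lra).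
exists K, (Rmin d' (d / (Rabs K' + 1))); split.
- apply Rmin_pos; [exact Hd' | now apply Rdiv_lt_0_compat].
- intros h Hh. apply H. rewrite Cmod_mult.
  assert (H1 : Cmod h < d') by (eapply Rlt_le_trans; [exact Hh | apply Rmin_l]).
  assert (H2 : Cmod h < d / (Rabs K' + 1)) by (eapply Rlt_le_trans; [exact Hh | apply Rmin_r]).
  apply Rmult_lt_compat_r with (r := Rabs K' + 1) in H2; [|exact HK].
  replace (d / (Rabs K' + 1) * (Rabs K' + 1)) with d in H2 by (field; lra).
  assert (H3 := H' h H1). assert (T := Rle_abs K'). assert (T' := Cmod_ge_0 h).
  nra.
Qed.

Lemma lb_ext_loc (f g : C -> C) (d : R) :
  0 < d -> (forall h, Cmod h < d -> f h = g h) -> loc_bounded f -> loc_bounded g.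
Proof.
intros Hd E [K [d' [Hd' H]]]. exists K, (Rmin d d'); split; [now apply Rmin_pos|].
intros h Hh. rewrite <- E; [apply H|]; (eapply Rlt_le_trans; [exact Hh|]);
  [apply Rmin_r | apply Rmin_l].
Qed.

Ltac lb := repeat first [assumption | apply lb_const | apply lb_id | apply lb_plus
  | apply lb_minus | apply lb_opp | apply lb_mult | apply lb_pow
  | (apply lb_comp; [assumption|])].

(** The identity is demanded for every h, so that expansions combine by [ring] without radii. It is
    still a local notion, since r is unconstrained away from 0. *)
Definition taylor2 (g : C -> C) (z A B D : C) : Prop :=
  exists r : C -> C, loc_bounded r /\
    forall h : C, g (z + h)%C = (A + B * h + D * h ^ 2 + h ^ 3 * r h)%C.

(** A local expansion suffices: outside the ball h is nonzero, and dividing by h^3 defines the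
    remainder there. *)
Lemma taylor2_intro (g : C -> C) (z A B D : C) (d : R) (r : C -> C) :
  0 < d -> loc_bounded r ->
  (forall h, Cmod h < d -> g (z + h)%C = (A + B * h + D * h ^ 2 + h ^ 3 * r h)%C) ->
  taylor2 g z A B D.
Proof.
intros Hd Hr H.
exists (fun h => if Rlt_dec (Cmod h) d then r h
  else ((g (z + h) - (A + B * h + D * h ^ 2)) / h ^ 3)%C).
split.
- apply (lb_ext_loc r _ d Hd); [|exact Hr]. intros h Hh.
  destruct (Rlt_dec (Cmod h) d) as [_|N]; [reflexivity | contradiction].
- intros h. destruct (Rlt_dec (Cmod h) d) as [Hh|N]; [now apply H|].
  field. intros E. apply N. rewrite E, Cmod_0. exact Hd.
Qed.

Lemma taylor2_ext_loc (f g : C -> C) (z A B D : C) (d : R) :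
  0 < d -> (forall h, Cmod h < d -> f (z + h)%C = g (z + h)%C) ->
  taylor2 f z A B D -> taylor2 g z A B D.
Proof.
intros Hd E [r [Hr H]]. apply (taylor2_intro g z A B D d r Hd Hr).
intros h Hh. rewrite <- E by exact Hh. apply H.
Qed.

Lemma taylor2_ext (f g : C -> C) (z A B D : C) :
  (forall x, f x = g x) -> taylor2 f z A B D -> taylor2 g z A B D.
Proof. intros E [r [Hr H]]. exists r. split; [exact Hr|]. intros h. now rewrite <- E. Qed.

Lemma taylor2_value (g : C -> C) (z A B D : C) : taylor2 g z A B D -> g z = A.
Proof.
intros [r [_ H]]. specialize (H (RtoC 0)).
replace (z + 0)%C with z in H by ring. rewrite H. ring.
Qed.

Lemma taylor2_const (c z : C) : taylor2 (fun _ => c) z c 0 0.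
Proof. exists (fun _ => RtoC 0). split; [lb|]. intros; ring. Qed.

Lemma taylor2_id (z : C) : taylor2 (fun x => x) z z 1 0.
Proof. exists (fun _ => RtoC 0). split; [lb|]. intros; ring. Qed.

Lemma taylor2_plus (f g : C -> C) (z A B D A' B' D' : C) :
  taylor2 f z A B D -> taylor2 g z A' B' D' ->
  taylor2 (fun x => f x + g x)%C z (A + A') (B + B') (D + D').
Proof.
intros [r [Hr H]] [r' [Hr' H']]. exists (fun h => r h + r' h)%C. split; [lb|].
intros h. rewrite H, H'. ring.
Qed.

Lemma taylor2_mult (f g : C -> C) (z A B D A' B' D' : C) :
  taylor2 f z A B D -> taylor2 g z A' B' D' ->
  taylor2 (fun x => f x * g x)%C z (A * A') (A * B' + B * A') (A * D' + B * B' + D * A').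
Proof.
intros [r [Hr H]] [r' [Hr' H']].
exists (fun h => (A + B * h + D * h ^ 2 + h ^ 3 * r h) * r' h + r h * (A' + B' * h + D' * h ^ 2)
  + B * D' + D * B' + D * D' * h)%C.
split; [lb|]. intros h. rewrite H, H'. ring.
Qed.

Lemma taylor2_comp (g w : C -> C) (z w0 b c A B D : C) :
  taylor2 w z w0 b c -> taylor2 g w0 A B D ->
  taylor2 (fun x => g (w x)) z A (B * b) (B * c + D * b ^ 2).
Proof.
intros [r [Hr H]] [r' [Hr' H']].
pose (s := fun h => (b + c * h + h ^ 2 * r h)%C).
assert (Hs : loc_bounded s) by (unfold s; lb).
exists (fun h => B * r h + D * (2 * b * (c + h * r h) + h * (c + h * r h) ^ 2)
  + s h ^ 3 * r' (h * s h))%C.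
split; [lb|]. intros h. rewrite H.
replace (w0 + b * h + c * h ^ 2 + h ^ 3 * r h)%C with (w0 + h * s h)%C by (unfold s; ring).
(* The remainder is frozen as q before the last unfolding, so that [ring] sees it as one atom on
   both sides. *)
rewrite H'. unfold s at 1 2 3. set (q := r' (h * s h)%C). unfold s. ring.
Qed.

Lemma Cmod_minus_sym (x y : C) : Cmod (x - y) = Cmod (y - x).
Proof. rewrite <- Cmod_opp. f_equal. ring. Qed.

Lemma Cmod_minus_ge (x y : C) : Cmod x - Cmod y <= Cmod (x - y).
Proof.
assert (H := Cmod_triangle (x - y) y). replace (x - y + y)%C with x in H by ring. lra.
Qed.

Lemma Cmod_plus_ge (x y : C) : Cmod x - Cmod y <= Cmod (x + y).
Proof.
assert (H := Cmod_minus_ge x (- y)). rewrite Cmod_opp in H.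
replace (x - - y)%C with (x + y)%C in H by ring. exact H.
Qed.

Lemma taylor2_inv (z : C) :
  z <> 0 -> taylor2 Cinv z (/ z) (- / z ^ 2) (/ z ^ 3).
Proof.
intros Hz. assert (Hp := proj1 (Cmod_gt_0 z) Hz).
(* The remainder of the finite geometric expansion of 1/(z + h); radius |z|/2 keeps |z + h| at least
   |z|/2. *)
apply (taylor2_intro _ _ _ _ _ (Cmod z / 2) (fun h => - (/ z ^ 3 * / (z + h)))%C); [lra| |].
- apply lb_opp, lb_mult; [lb|]. exists (2 / Cmod z), (Cmod z / 2). split; [lra|].
  intros h Hh. assert (H := Cmod_plus_ge z h).
  rewrite Cmod_inv by (apply Cmod_gt_0; lra).
  replace (2 / Cmod z) with (/ (Cmod z / 2)) by (field; lra).
  apply Rinv_le_contravar; lra.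
- intros h Hh. assert (H := Cmod_plus_ge z h).
  assert (Hn : (z + h)%C <> 0) by (apply Cmod_gt_0; lra). field. now split.
Qed.

Lemma taylor2_Cinv (g : C -> C) (z A B D : C) :
  taylor2 g z A B D -> A <> 0 ->
  taylor2 (fun x => / g x)%C z (/ A) (- B / A ^ 2) (B ^ 2 / A ^ 3 - D / A ^ 2).
Proof.
intros H HA. assert (T := taylor2_comp _ _ _ _ _ _ _ _ _ H (taylor2_inv A HA)).
replace (- B / A ^ 2)%C with (- / A ^ 2 * B)%C by (field; exact HA).
replace (B ^ 2 / A ^ 3 - D / A ^ 2)%C with (- / A ^ 2 * D + / A ^ 3 * B ^ 2)%C
  by (field; exact HA).
exact T.
Qed.

Lemma taylor2_lip (g : C -> C) (z A B D : C) :
  taylor2 g z A B D ->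
  exists s, loc_bounded s /\ forall h, g (z + h)%C = (A + h * s h)%C.
Proof.
intros [r [Hr H]]. exists (fun h => B + D * h + h ^ 2 * r h)%C. split; [lb|].
intros h. rewrite H. ring.
Qed.

Lemma lb_small (s : C -> C) (e : R) :
  loc_bounded s -> 0 < e ->
  exists d, 0 < d /\ forall h, Cmod h < d -> Cmod (h * s h) < e.
Proof.
intros Hs He. destruct Hs as [K [d [Hd H]]].
assert (HK : 0 < Rabs K + 1) by (assert (T := Rabs_pos K); lra).
exists (Rmin d (e / (Rabs K + 1))). split.
- apply Rmin_pos; [exact Hd | now apply Rdiv_lt_0_compat].
- intros h Hh. rewrite Cmod_mult.
  assert (H1 : Cmod h < d) by (eapply Rlt_le_trans; [exact Hh | apply Rmin_l]).
  assert (H2 : Cmod h < e / (Rabs K + 1)) by (eapply Rlt_le_trans; [exact Hh | apply Rmin_r]).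
  apply Rmult_lt_compat_r with (r := Rabs K + 1) in H2; [|exact HK].
  replace (e / (Rabs K + 1) * (Rabs K + 1)) with e in H2 by (field; lra).
  assert (H3 := H h H1). assert (T := Rle_abs K). assert (T' := Cmod_ge_0 h). nra.
Qed.

(** Replaces letting h tend to 0: a small real h makes |h s(h)| < |a| unless a = 0. *)
Lemma lb_limit (a : C) (s : C -> C) :
  loc_bounded s -> (forall h : C, h <> 0 -> (a + h * s h)%C = 0) -> a = 0.
Proof.
intros Hs H. apply Cmod_eq_0.
destruct (Rle_lt_or_eq_dec 0 (Cmod a) (Cmod_ge_0 a)) as [P|E]; [|now symmetry].
exfalso. destruct (lb_small s _ Hs P) as [d [Hd Q]].
assert (Hh : Cmod (RtoC (d / 2)) = d / 2) by (rewrite Cmod_R, Rabs_pos_eq; lra).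
assert (Hn : RtoC (d / 2) <> 0) by (apply Cmod_gt_0; lra).
specialize (Q (RtoC (d / 2))). rewrite Hh in Q. specialize (Q ltac:(lra)).
specialize (H _ Hn).
assert (G := Cmod_plus_ge a (RtoC (d / 2) * s (RtoC (d / 2)))%C).
rewrite H, Cmod_0 in G. lra.
Qed.

Lemma taylor2_unique (g : C -> C) (z A B D A' B' D' : C) :
  taylor2 g z A B D -> taylor2 g z A' B' D' -> B = B' /\ D = D'.
Proof.
intros H H'. assert (EA : A = A').
{ rewrite <- (taylor2_value _ _ _ _ _ H). exact (taylor2_value _ _ _ _ _ H'). }
subst A'. destruct H as [r [Hr H]], H' as [r' [Hr' H']].
assert (E : forall h : C, h <> 0 -> (B - B' + h * (D - D' + h * (r h - r' h)))%C = 0).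
{ intros h Hh. assert (E := H h). rewrite H' in E.
  assert (E2 : (h * (B - B' + h * (D - D' + h * (r h - r' h))))%C = 0).
  { transitivity ((A + B * h + D * h ^ 2 + h ^ 3 * r h) - (A + B' * h + D' * h ^ 2 + h ^ 3 * r' h))%C;
    [ring | rewrite <- E; ring]. }
  replace (B - B' + h * (D - D' + h * (r h - r' h)))%C
    with (/ h * (h * (B - B' + h * (D - D' + h * (r h - r' h)))))%C by (field; exact Hh).
  rewrite E2. ring. }
assert (EB : (B - B')%C = 0) by (refine (lb_limit _ _ _ E); lb).
assert (ED : (D - D')%C = 0).
{ apply (lb_limit _ (fun h => r h - r' h)%C); [lb|]. intros h Hh.
  specialize (E h Hh). rewrite EB in E.
  replace (D - D' + h * (r h - r' h))%C
    with (/ h * (0 + h * (D - D' + h * (r h - r' h))))%C by (field; exact Hh).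
  rewrite E. ring. }
split; [replace B with (B - B' + B')%C by ring; rewrite EB
  | replace D with (D - D' + D')%C by ring; rewrite ED]; ring.
Qed.

(* Writing [s (z + h) = s0 + h * sigma h], the two expansions of [phi (s (z + h))]
   determine [sigma h] up to O(h), and feeding this back up to O(h^2). *)
Lemma taylor2_local_inverse (phi s sigma : C -> C) (z s0 A B D A1 B1 D1 : C) :
  taylor2 phi s0 A B D -> B <> 0 ->
  loc_bounded sigma -> (forall h, s (z + h)%C = (s0 + h * sigma h)%C) ->
  taylor2 (fun x => phi (s x)) z A1 B1 D1 ->
  taylor2 s z s0 (B1 / B) ((D1 - D * (B1 / B) ^ 2) / B).
Proof.
intros Hphi HB Hsig Hs Hc.
assert (EA : A1 = A).
{ rewrite <- (taylor2_value _ _ _ _ _ Hc), <- (taylor2_value _ _ _ _ _ Hphi). f_equal.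
  specialize (Hs (RtoC 0)). replace (z + 0)%C with z in Hs by ring. rewrite Hs. ring. }
subst A1. destruct Hphi as [r [Hr H]], Hc as [r1 [Hr1 H1]].
set (b := (B1 / B)%C).
pose (tau := fun h => ((D1 - D * sigma h ^ 2 + h * (r1 h - sigma h ^ 3 * r (h * sigma h))) / B)%C).
assert (Htau : loc_bounded tau) by (unfold tau, Cdiv; lb).
assert (E : forall h : C, h <> 0 -> sigma h = (b + h * tau h)%C).
{ intros h Hh. assert (E := H (h * sigma h)%C). rewrite <- Hs in E.
  assert (E1 := H1 h). rewrite E in E1. unfold b, tau.
  assert (E2 : (h * (B * sigma h + h * D * sigma h ^ 2 + h ^ 2 * sigma h ^ 3 * r (h * sigma h)
     - B1 - D1 * h - h ^ 2 * r1 h))%C = 0).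
  { transitivity ((A + B * (h * sigma h) + D * (h * sigma h) ^ 2 + (h * sigma h) ^ 3 * r (h * sigma h))
      - (A + B1 * h + D1 * h ^ 2 + h ^ 3 * r1 h))%C; [ring | rewrite E1; ring]. }
  set (q := r (h * sigma h)%C) in *.
  assert (E3 : (B * sigma h + h * D * sigma h ^ 2 + h ^ 2 * sigma h ^ 3 * q
     - B1 - D1 * h - h ^ 2 * r1 h)%C = 0).
  { match goal with |- ?X = _ => replace X with (/ h * (h * X))%C by (field; exact Hh) end.
    rewrite E2. ring. }
  replace (sigma h) with ((B * sigma h + h * D * sigma h ^ 2 + h ^ 2 * sigma h ^ 3 * q
     - B1 - D1 * h - h ^ 2 * r1 h) / B + (B1 / B + h * ((D1 - D * sigma h ^ 2
     + h * (r1 h - sigma h ^ 3 * q)) / B)))%C at 1 by (field; exact HB).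
  rewrite E3. field. exact HB. }
exists (fun h => (- D * (2 * b * tau h + h * tau h ^ 2)
   + (r1 h - sigma h ^ 3 * r (h * sigma h))) / B)%C.
split; [unfold Cdiv; lb|]. intros h.
destruct (Ceq_dec h 0) as [Z|N].
- rewrite Hs, Z. unfold b. field. exact HB.
(* [sigma] is expanded once to reach [tau], then again inside the square there: D (sigma^2 - b^2) =
   h D (2 b tau + h tau^2) joins the cubic remainder. *)
- rewrite Hs. rewrite (E h N) at 1. unfold tau at 1.
  set (q := r (h * sigma h)%C). rewrite (E h N) at 1. field. exact HB.
Qed.

Lemma is_derive_of_quadratic (g : C -> C) (z B : C) (s : C -> C) :
  loc_bounded s -> (forall h, g (z + h)%C = (g z + B * h + h ^ 2 * s h)%C) ->
  is_derive (K := C_AbsRing) (V := C_NormedModule) g z B.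
Proof.
intros Hs H. split; [apply is_linear_scal_l|].
intros x Hx. replace x with z
  by (apply (is_filter_lim_locally_unique (V := AbsRing_NormedModule C_AbsRing)); exact Hx).
intros eps. destruct (lb_small s eps Hs (cond_pos eps)) as [d [Hd Q]].
assert (G : forall y : C, Cmod (y - z) < d ->
  Cmod ((g y - g z) - (y - z) * B) <= eps * Cmod (y - z)); [|exists (mkposreal _ Hd); exact G].
intros y Hy.
assert (E := H (y - z)%C). replace (z + (y - z))%C with y in E by ring.
rewrite E.
replace (g z + B * (y - z) + (y - z) ^ 2 * s (y - z) - g z - (y - z) * B)%C
  with ((y - z) * s (y - z) * (y - z))%C by ring.
rewrite Cmod_mult. apply Rmult_le_compat_r; [apply Cmod_ge_0|]. left. now apply Q.
Qed.

Lemma is_derive_taylor2 (g : C -> C) (z A B D : C) :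
  taylor2 g z A B D -> is_derive (K := C_AbsRing) (V := C_NormedModule) g z B.
Proof.
intros H. assert (EA := taylor2_value _ _ _ _ _ H). destruct H as [r [Hr H]].
apply (is_derive_of_quadratic _ _ _ (fun h => D + h * r h)%C); [lb|].
intros h. rewrite H, EA. ring.
Qed.

(** Near z the difference quotient is bounded by |l| + 1. This Lipschitz form is what
    [taylor2_local_inverse] asks of the inner function. *)
Lemma ex_derive_lip (g : C -> C) (z : C) :
  ex_derive (K := C_AbsRing) (V := C_NormedModule) g z ->
  exists s, loc_bounded s /\ forall h, g (z + h)%C = (g z + h * s h)%C.
Proof.
intros [l0 [_ H]]. pose (l := l0 : C). specialize (H z (fun P HP => HP) (mkposreal 1 Rlt_0_1)).
destruct H as [d H].
exists (fun h => if Ceq_dec h 0 then RtoC 0 else (g (z + h) - g z) / h)%C. split.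
- exists (Cmod l + 1), d. split; [apply cond_pos|]. intros h Hh.
  destruct (Ceq_dec h 0) as [E|N].
  + rewrite Cmod_0. assert (T := Cmod_ge_0 l). lra.
  + specialize (H (z + h)%C).
    assert (Hb : Cmod (z + h - z) < d) by (replace (z + h - z)%C with h by ring; exact Hh).
    specialize (H Hb).
    change (Cmod ((g (z + h)%C - g z) - (z + h - z) * l) <= 1 * Cmod (z + h - z)) in H.
    replace (z + h - z)%C with h in H by ring.
    assert (T := Cmod_minus_ge (g (z + h)%C - g z)%C (h * l)%C).
    rewrite Cmod_mult in T. rewrite Cmod_div by exact N.
    assert (P := proj1 (Cmod_gt_0 h) N). apply Rle_div_l; [exact P|]. nra.
- intros h. destruct (Ceq_dec h 0) as [E|N].
  + rewrite E. replace (z + 0)%C with z by ring. ring.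
  + field. exact N.
Qed.

(** * Maximum principle *)

Lemma Cmod_le_Rabs (x y : R) : Cmod (x, y) <= Rabs x + Rabs y.
Proof.
replace ((x, y) : C) with (x + Ci * y)%C by (unfold Ci, RtoC, Cplus, Cmult; simpl; f_equal; ring).
eapply Rle_trans; [apply Cmod_triangle|]. rewrite Cmod_mult, Cmod_Ci, !Cmod_R. lra.
Qed.

Lemma list_argmax {T : Type} (phi : T -> R) (l : list T) (t : T) :
  List.In t l -> exists m, List.In m l /\ forall x, List.In x l -> phi x <= phi m.
Proof.
revert t. induction l as [|a l IH]; intros t Ht; [destruct Ht|].
destruct l as [|b l].
- exists a. split; [now left|]. intros x [->|[]]. lra.
- destruct (IH b (or_introl eq_refl)) as [m [Hm H]].
  destruct (Rle_dec (phi a) (phi m)) as [L|G].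
  + exists m. split; [now right|]. intros x [<-|Hx]; [exact L | now apply H].
  + exists a. split; [now left|]. intros x [<-|Hx]; [lra|]. specialize (H x Hx). lra.
Qed.

(** An upper semicontinuous function attains its maximum. Otherwise each u has a ball on which phi
    stays below its value at some point of the disk; among finitely many covering balls take the one
    with the largest such value, and the point giving it lies in another ball, which beats it. *)
Lemma closed_disk_max (phi : C -> R) (r : R) :
  0 <= r ->
  (forall u c, Cmod u <= r -> phi u < c ->
     exists d, 0 < d /\ forall v, Cmod v <= r -> Cmod (v - u) < d -> phi v < c) ->
  exists m, Cmod m <= r /\ forall v, Cmod v <= r -> phi v <= phi m.
Proof.
intros Hr Husc. apply NNPP. intros Hno.
assert (Hloc : forall u : C, exists p : posreal * C, Cmod (snd p) <= r /\
  forall v, Cmod v <= r -> Cmod (v - u) < fst p -> phi v < phi (snd p)).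
{ intros u. destruct (Rle_dec (Cmod u) r) as [Hu|Hu].
  - destruct (classic (exists v, Cmod v <= r /\ phi u < phi v)) as [[v [Hv L]]|N].
    + destruct (Husc u (phi v) Hu L) as [d [Hd H]]. exists (mkposreal d Hd, v). now split.
    + exfalso. apply Hno. exists u. split; [exact Hu|]. intros v Hv.
      apply Rnot_lt_le. intros L. apply N. now exists v.
  (* The compactness theorem covers a square, so centres outside the disk also need a ball; this one
     misses the disk. *)
  - assert (Hd : 0 < Cmod u - r) by lra.
    exists (mkposreal _ Hd, RtoC 0). simpl. split; [now rewrite Cmod_0|].
    intros v Hv Hvu. exfalso. assert (T := Cmod_minus_ge u v).
    rewrite Cmod_minus_sym in Hvu. lra. }
pose (ch := fun u => proj1_sig (constructive_indefinite_description _ (Hloc u))).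
assert (Hch : forall u, Cmod (snd (ch u)) <= r /\
  forall v, Cmod v <= r -> Cmod (v - u) < fst (ch u) -> phi v < phi (snd (ch u))).
{ intros u. exact (proj2_sig (constructive_indefinite_description _ (Hloc u))). }
clearbody ch.
pose (pt := fun t : Compactness.Tn 2 R => (fst t, fst (snd t)) : C).
(* The finite subcover exists only under a double negation, which suffices for the goal [False].
   Radii are halved because closeness is measured per coordinate. *)
apply (compactness_list 2 (- r, (- r, tt)) (r, (r, tt)) (fun t => pos_div_2 (fst (ch (pt t))))).
intros [l Hl].
assert (Hcov : forall v, Cmod v <= r -> exists t, List.In t l /\ phi v < phi (snd (ch (pt t)))).
{ intros v Hv. destruct (Hl (fst v, (snd v, tt))) as [t [Ht [_ Hc]]].
  - simpl. assert (T := Rmax_Cmod v). assert (T1 := Rmax_l (Rabs (fst v)) (Rabs (snd v))).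
    assert (T2 := Rmax_r (Rabs (fst v)) (Rabs (snd v))).
    split; [|split; [|exact I]]; apply Rabs_le_between; lra.
  - exists t. split; [exact Ht|]. apply (Hch (pt t)); [exact Hv|].
    destruct t as [t1 [t2 []]], v as [v1 v2]. simpl in Hc. destruct Hc as [H1 [H2 _]].
    eapply Rle_lt_trans; [apply Cmod_le_Rabs|]. unfold pt in *. simpl in *. unfold Rminus in *. lra. }
assert (H0 : Cmod (RtoC 0) <= r) by now rewrite Cmod_0.
destruct (Hcov _ H0) as [t [Ht _]].
destruct (list_argmax (fun t => phi (snd (ch (pt t)))) l t Ht) as [m [Hm Hmax]].
destruct (Hcov _ (proj1 (Hch (pt m)))) as [t' [Ht' L]].
specialize (Hmax t' Ht'). simpl in Hmax. lra.
Qed.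

(** Summed over h = t, it, -t, -it, the cross terms in A, B, D cancel and only squares of moduli
    remain. Since B and D may vanish, the strict gain comes from eps |z|^2: it contributes 4 eps
    t^2, against errors of order t^3. *)
Lemma taylor2_no_max (g : C -> C) (z A B D : C) (eps d : R) :
  taylor2 g z A B D -> 0 < eps -> 0 < d ->
  ~ (forall h, Cmod h < d -> Cmod (g (z + h)%C) ^ 2 + eps * Cmod (z + h) ^ 2
                          <= Cmod (g z) ^ 2 + eps * Cmod z ^ 2).
Proof.
intros Hg He Hd Hmax. rewrite (taylor2_value _ _ _ _ _ Hg) in Hmax.
destruct Hg as [r [[K [d' [Hd' HK]]] H]].
set (M := Cmod A + Cmod B + Cmod D).
assert (HA := Cmod_ge_0 A). assert (HB := Cmod_ge_0 B). assert (HD := Cmod_ge_0 D).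
assert (HK0 : 0 <= K).
{ eapply Rle_trans; [apply Cmod_ge_0|]. apply (HK (RtoC 0)). now rewrite Cmod_0. }
assert (HM : 0 <= M * K) by (apply Rmult_le_pos; unfold M; lra).
(* t < 1 bounds the quadratic polynomial by M, and the last bound makes 2 M K t^3 < eps t^2. *)
set (t := Rmin 1 (Rmin d (Rmin d' (eps / (2 * (M * K) + 1)))) / 2).
assert (Hq : 0 < eps / (2 * (M * K) + 1)) by (apply Rdiv_lt_0_compat; lra).
assert (Ht : 0 < t /\ t < 1 /\ t < d /\ t < d' /\ t < eps / (2 * (M * K) + 1)).
{ unfold t.
  assert (0 < Rmin 1 (Rmin d (Rmin d' (eps / (2 * (M * K) + 1)))))
    by (repeat apply Rmin_pos; lra).
  assert (X1 := Rmin_l 1 (Rmin d (Rmin d' (eps / (2 * (M * K) + 1))))).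
  assert (X2 := Rmin_r 1 (Rmin d (Rmin d' (eps / (2 * (M * K) + 1))))).
  assert (X3 := Rmin_l d (Rmin d' (eps / (2 * (M * K) + 1)))).
  assert (X4 := Rmin_r d (Rmin d' (eps / (2 * (M * K) + 1)))).
  assert (X5 := Rmin_l d' (eps / (2 * (M * K) + 1))).
  assert (X6 := Rmin_r d' (eps / (2 * (M * K) + 1))). lra. }
destruct Ht as [Ht0 [Ht1 [Htd [Htd' Hte]]]]. clearbody t.
assert (Q : forall h, Cmod h = t ->
  Cmod (A + B * h + D * h ^ 2) ^ 2 + eps * Cmod (z + h) ^ 2
  <= Cmod A ^ 2 + eps * Cmod z ^ 2 + 2 * (M * K) * t ^ 3).
{ intros h Hh. assert (L := Hmax h ltac:(lra)). rewrite H in L.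
  assert (HP : Cmod (A + B * h + D * h ^ 2) <= M).
  { eapply Rle_trans; [apply Cmod_triangle|]. unfold M. apply Rplus_le_compat.
    - eapply Rle_trans; [apply Cmod_triangle|]. apply Rplus_le_compat; [lra|].
      rewrite Cmod_mult, Hh. nra.
    - rewrite Cmod_mult, Cmod_pow, Hh. assert (0 <= t ^ 2 <= 1) by nra. nra. }
  assert (T := Cmod_plus_ge (A + B * h + D * h ^ 2) (h ^ 3 * r h)).
  assert (HE : Cmod (h ^ 3 * r h) <= K * t ^ 3).
  { rewrite Cmod_mult, Cmod_pow, Hh, Rmult_comm.
    apply Rmult_le_compat_r; [apply pow_le; lra | apply HK; lra]. }
  set (p := Cmod (A + B * h + D * h ^ 2)) in *.
  set (q := Cmod (A + B * h + D * h ^ 2 + h ^ 3 * r h)) in *.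
  assert (Hp0 : 0 <= p) by apply Cmod_ge_0. assert (Hq0 : 0 <= q) by apply Cmod_ge_0.
  assert (Ht3 : 0 <= K * t ^ 3) by (apply Rmult_le_pos; [lra | apply pow_le; lra]).
  set (e := K * t ^ 3) in *.
  replace (2 * (M * K) * t ^ 3) with (2 * M * e) by (unfold e; ring).
  assert (p ^ 2 - 2 * p * e <= q ^ 2).
  (* For e <= p square q >= p - e; for e > p the left side is at most 0. *)
  { destruct (Rle_dec e p) as [Hep|Hep]; nra. }
  assert (p * e <= M * e) by (apply Rmult_le_compat_r; assumption). lra. }
assert (Hm : forall x y : R, x ^ 2 + y ^ 2 = t ^ 2 -> Cmod (x, y) = t).
{ intros x y E. unfold Cmod. simpl fst; simpl snd. rewrite E. now apply sqrt_pow2, Rlt_le. }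
assert (Q1 := Q (t, 0) (Hm t 0 ltac:(ring))).
assert (Q2 := Q (0, t) (Hm 0 t ltac:(ring))).
assert (Q3 := Q (- t, 0) (Hm (- t) 0 ltac:(ring))).
assert (Q4 := Q (0, - t) (Hm 0 (- t) ltac:(ring))).
assert (S : (Cmod (A + B * (t, 0) + D * (t, 0) ^ 2) ^ 2 + eps * Cmod (z + (t, 0)) ^ 2)
  + (Cmod (A + B * (0, t) + D * (0, t) ^ 2) ^ 2 + eps * Cmod (z + (0, t)) ^ 2)
  + (Cmod (A + B * (- t, 0)%R + D * (- t, 0)%R ^ 2) ^ 2 + eps * Cmod (z + (- t, 0)%R) ^ 2)
  + (Cmod (A + B * (0, - t)%R + D * (0, - t)%R ^ 2) ^ 2 + eps * Cmod (z + (0, - t)%R) ^ 2)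
  = 4 * (Cmod A ^ 2 + Cmod B ^ 2 * t ^ 2 + Cmod D ^ 2 * t ^ 4)
    + 4 * eps * (Cmod z ^ 2 + t ^ 2)).
{ rewrite !Cmod2_alt. destruct A, B, D, z. unfold Cplus, Cmult, Cpow, Re, Im. simpl. ring. }
assert (H2 : 0 <= Cmod B ^ 2 * t ^ 2) by (rewrite <- Rpow_mult_distr; apply pow2_ge_0).
assert (H4 : 0 <= Cmod D ^ 2 * t ^ 4).
{ apply Rmult_le_pos; [apply pow2_ge_0 | apply pow_le; lra]. }
assert (F : eps * t ^ 2 <= 2 * (M * K) * t ^ 3) by lra.
assert (F2 : (2 * (M * K) * t) * t ^ 2 < eps * t ^ 2).
{ apply Rmult_lt_compat_r; [apply pow_lt; lra|].
  apply (Rmult_lt_compat_r (2 * (M * K) + 1)) in Hte; [|lra].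
  replace (eps / (2 * (M * K) + 1) * (2 * (M * K) + 1)) with eps in Hte by (field; lra). lra. }
lra.
Qed.

Lemma taylor2_pow (g : C -> C) (z A B D : C) (n : nat) :
  taylor2 g z A B D -> exists A' B' D', taylor2 (fun x => g x ^ n)%C z A' B' D'.
Proof.
intros Hg. induction n as [|n [A' [B' [D' IH]]]].
- do 3 eexists. exact (taylor2_const 1 z).
- do 3 eexists. exact (taylor2_mult _ _ _ _ _ _ _ _ _ Hg IH).
Qed.

(** A constant factor disappears under n-th roots: if a > b, the powers of a/b exceed every K. *)
Lemma pow_bound (a b K : R) :
  0 <= a -> 0 < b -> (forall n : nat, a ^ n <= K * b ^ n) -> a <= b.
Proof.
intros Ha Hb H. apply Rnot_lt_le. intros L.
assert (Hq : 1 < a / b) by (apply (Rmult_lt_reg_r b); [exact Hb|]; field_simplify; lra).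
destruct (Pow_x_infinity (a / b)) with (b := K + 1) as [N HN].
- rewrite Rabs_pos_eq; lra.
- specialize (HN N (Nat.le_refl N)).
  rewrite Rabs_pos_eq in HN by (apply pow_le; lra).
  specialize (H N). unfold Rdiv in HN. rewrite Rpow_mult_distr, pow_inv in HN.
  assert (Hp : 0 < b ^ N) by now apply pow_lt.
  apply Rge_le in HN. apply (Rmult_le_compat_r (b ^ N)) in HN; [|lra].
  replace (a ^ N * / b ^ N * b ^ N) with (a ^ N) in HN by (field; lra). nra.
Qed.

(* For a bounded singularity at 0 the factor z in (g z)^n z forces the value 0 there, so
   the maximum of the perturbed modulus cannot sit at 0; taking n-th roots removes it again. *)
Lemma punctured_max_modulus (g : C -> C) (r M : R) :
  0 < r -> 0 < M ->
  (forall z : C, z <> 0 -> Cmod z <= r -> exists A B D, taylor2 g z A B D) ->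
  loc_bounded g ->
  (forall z, Cmod z = r -> Cmod (g z) <= M) ->
  forall z : C, z <> 0 -> Cmod z <= r -> Cmod (g z) <= M.
Proof.
intros Hr HM Hg Hb Hbd z Hz Hzr. assert (Hz0 := proj1 (Cmod_gt_0 z) Hz).
(* The constant comes from |g z|^n |z| <= M^n r, the maximum principle for g^n times z. *)
apply (pow_bound _ _ (r / Cmod z) (Cmod_ge_0 _) HM). intros n.
pose (G := fun x => (g x ^ n * x)%C).
assert (HG : forall x : C, x <> 0 -> Cmod x <= r -> exists A B D, taylor2 G x A B D).
{ intros x Hx Hxr. destruct (Hg x Hx Hxr) as [A [B [D T]]].
  destruct (taylor2_pow _ _ _ _ _ n T) as [A' [B' [D' T']]].
  do 3 eexists. exact (taylor2_mult _ _ _ _ _ _ _ _ _ T' (taylor2_id x)). }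
assert (HG0 : exists s, loc_bounded s /\ forall h, G (0 + h)%C = (0 + h * s h)%C).
{ exists (fun h => g h ^ n)%C. split; [lb|]. intros h. unfold G.
  replace (0 + h)%C with h by ring. ring. }
assert (HGr : forall x, Cmod x = r -> Cmod (G x) <= M ^ n * r).
{ intros x Hx. unfold G. rewrite Cmod_mult, Cmod_pow, Hx.
  apply Rmult_le_compat_r; [lra|]. apply pow_incr. split; [apply Cmod_ge_0 | now apply Hbd]. }
assert (HGc : forall u, Cmod u <= r ->
  exists s, loc_bounded s /\ forall h, G (u + h)%C = (G u + h * s h)%C).
{ intros u Hu. destruct (Ceq_dec u 0) as [->|N].
  - destruct HG0 as [s [Hs E]]. exists s. split; [exact Hs|]. intros h. rewrite E. unfold G. ring.
  - destruct (HG u N Hu) as [A [B [D T]]]. rewrite (taylor2_value _ _ _ _ _ T).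
    exact (taylor2_lip _ _ _ _ _ T). }
assert (HP : forall eps, 0 < eps -> Cmod (G z) ^ 2 <= (M ^ n * r) ^ 2 + eps * r ^ 2).
{ intros eps He.
  destruct (closed_disk_max (fun x => Cmod (G x) ^ 2 + eps * Cmod x ^ 2) r) as [m [Hm Hmax]]; [lra| |].
  - intros u c Hu Hc. destruct (HGc u Hu) as [s [Hs E]].
    (* If |G v| < |G u| + e and |v| < |u| + e with e <= 1, the perturbed square grows by less than Q
       e. *)
    set (Q := 2 * Cmod (G u) + 1 + eps * (2 * Cmod u + 1)).
    assert (X1 := Cmod_ge_0 (G u)). assert (X2 := Cmod_ge_0 u).
    assert (HQ : 0 < Q) by (unfold Q; assert (0 <= eps * (2 * Cmod u + 1)) by (apply Rmult_le_pos; lra); lra).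
    set (gap := c - (Cmod (G u) ^ 2 + eps * Cmod u ^ 2)).
    assert (Hgap : 0 < gap) by (unfold gap; lra).
    set (e := Rmin 1 (gap / Q)).
    assert (He0 : 0 < e) by (apply Rmin_pos; [lra | now apply Rdiv_lt_0_compat]).
    assert (He1 : e <= 1) by apply Rmin_l.
    assert (He2 : Q * e <= gap).
    { assert (T : e <= gap / Q) by apply Rmin_r.
      apply (Rmult_le_compat_l Q) in T; [|lra].
      replace (Q * (gap / Q)) with gap in T by (field; lra). exact T. }
    clearbody e. destruct (lb_small s e Hs He0) as [d [Hd HL]].
    exists (Rmin d e). split; [now apply Rmin_pos|]. intros v Hv Hvu.
    assert (Hv1 : Cmod (v - u) < d) by (eapply Rlt_le_trans; [exact Hvu | apply Rmin_l]).
    assert (Hv2 : Cmod (v - u) < e) by (eapply Rlt_le_trans; [exact Hvu | apply Rmin_r]).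
    assert (Ev := E (v - u)%C). replace (u + (v - u))%C with v in Ev by ring.
    specialize (HL _ Hv1).
    assert (Y1 : Cmod (G v) < Cmod (G u) + e).
    { rewrite Ev. eapply Rle_lt_trans; [apply Cmod_triangle|]. lra. }
    assert (Y2 : Cmod v < Cmod u + e).
    { replace v with (u + (v - u))%C by ring. eapply Rle_lt_trans; [apply Cmod_triangle|]. lra. }
    assert (Y3 := Cmod_ge_0 (G v)). assert (Y4 := Cmod_ge_0 v).
    assert (Z1 : Cmod (G v) ^ 2 < Cmod (G u) ^ 2 + (2 * Cmod (G u) + 1) * e) by nra.
    assert (Z2 : Cmod v ^ 2 < Cmod u ^ 2 + (2 * Cmod u + 1) * e) by nra.
    apply (Rmult_lt_compat_l eps) in Z2; [|exact He].
    unfold gap, Q in He2. lra.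
  - assert (Hz2 := Hmax z Hzr). cbv beta in Hz2.
    assert (T := pow2_ge_0 (Cmod z)).
    assert (Hez : 0 <= eps * Cmod z ^ 2) by (apply Rmult_le_pos; lra).
    assert (HT : 0 <= (M ^ n * r) ^ 2 + eps * r ^ 2).
    { apply Rplus_le_le_0_compat; [apply pow2_ge_0 | apply Rmult_le_pos; [lra | apply pow2_ge_0]]. }
    destruct (Ceq_dec m 0) as [E0|N0].
    + rewrite E0 in Hz2. unfold G in Hz2 at 2.
      rewrite Cmod_mult, Cmod_0 in Hz2. replace ((Cmod (g 0 ^ n) * 0) ^ 2 + eps * 0 ^ 2) with 0 in Hz2 by ring.
      lra.
    + destruct (Rle_lt_or_eq_dec _ _ Hm) as [L|Er].
      * exfalso. destruct (HG m N0 Hm) as [A [B [D Tm]]].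
        apply (taylor2_no_max G m A B D eps (r - Cmod m) Tm He); [lra|].
        intros h Hh. apply Hmax. eapply Rle_trans; [apply Cmod_triangle|]. lra.
      * assert (Hbm := HGr m Er). assert (Tm := Cmod_ge_0 (G m)).
        assert (Cmod (G m) ^ 2 <= (M ^ n * r) ^ 2) by (apply pow_incr; lra).
        rewrite Er in Hz2. lra. }
assert (HP2 : Cmod (G z) ^ 2 <= (M ^ n * r) ^ 2).
{ apply Rle_plus_epsilon. intros e He.
  assert (Hr2 : 0 < r ^ 2) by (apply pow_lt; lra).
  assert (X := HP (e / r ^ 2) ltac:(now apply Rdiv_lt_0_compat)).
  replace (e / r ^ 2 * r ^ 2) with e in X by (field; lra). exact X. }
assert (HMn : 0 <= M ^ n) by (apply pow_le; lra).
assert (HP3 : Cmod (G z) <= M ^ n * r).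
{ apply Rsqr_incr_0; [unfold Rsqr; lra | apply Cmod_ge_0 | apply Rmult_le_pos; lra]. }
unfold G in HP3. rewrite Cmod_mult, Cmod_pow in HP3.
replace (r / Cmod z * M ^ n) with (M ^ n * r / Cmod z) by (field; lra).
apply Rle_div_r; [lra | exact HP3].
Qed.

(** * Schwarz and Pick bounds *)

Definition taylor2_on_disk (g : C -> C) : Prop :=
  forall z, unit_disk z -> exists A B D, taylor2 g z A B D.

(** Passage to r = 1: boundary estimates are available only on circles inside the disk. *)
Lemma le_of_scaled_le (a b c : R) :
  c < 1 -> (forall r, c < r < 1 -> r * a <= b) -> a <= b.
Proof.
intros Hc H. apply Rle_plus_epsilon. intros e He.
assert (HA := Rabs_pos a). assert (HA' := Rle_abs a).
set (q := Rmin (1 - c) (e / (Rabs a + 1))).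
assert (Hq0 : 0 < q) by (apply Rmin_pos; [lra | apply Rdiv_lt_0_compat; lra]).
assert (Hq1 : q <= 1 - c) by apply Rmin_l.
assert (Hq2 : q * (Rabs a + 1) <= e).
{ assert (T : q <= e / (Rabs a + 1)) by apply Rmin_r.
  apply (Rmult_le_compat_r (Rabs a + 1)) in T; [|lra].
  replace (e / (Rabs a + 1) * (Rabs a + 1)) with e in T by (field; lra). exact T. }
specialize (H (1 - q / 2) ltac:(lra)).
assert (q * a <= q * Rabs a) by (apply Rmult_le_compat_l; lra). nra.
Qed.

(** Meant for quotients by h, whose value at 0 is a convention of division; the maximum absorbs
    it. *)
Lemma lb_punctured (f : C -> C) (K d : R) :
  0 < d -> (forall h : C, h <> 0 -> Cmod h < d -> Cmod (f h) <= K) -> loc_bounded f.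
Proof.
intros Hd H. exists (Rmax K (Cmod (f 0))), d. split; [exact Hd|]. intros h Hh.
destruct (Ceq_dec h 0) as [->|N]; [apply Rmax_r|].
eapply Rle_trans; [now apply H | apply Rmax_l].
Qed.

(** Stated without division so that |b| = 1 is covered; [blaschke_le] needs this for x = 1. *)
Lemma mobius_bound (a b : C) :
  Cmod a <= 1 -> Cmod b <= 1 -> Cmod (a - b) <= Cmod (1 - Cconj b * a).
Proof.
intros Ha Hb. assert (Ha0 := Cmod_ge_0 a). assert (Hb0 := Cmod_ge_0 b).
apply Rsqr_incr_0; try apply Cmod_ge_0. rewrite !Rsqr_pow2.
assert (E : Cmod (1 - Cconj b * a) ^ 2 - Cmod (a - b) ^ 2
  = (1 - Cmod a ^ 2) * (1 - Cmod b ^ 2)).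
{ rewrite !Cmod2_alt. destruct a, b. simpl. ring. }
assert (0 <= (1 - Cmod a ^ 2) * (1 - Cmod b ^ 2)) by (apply Rmult_le_pos; nra). lra.
Qed.

Lemma Cdiv_bound (x y : C) (K : R) : y <> 0 -> Cmod x <= K * Cmod y -> Cmod (x / y) <= K.
Proof.
intros Hy H. rewrite Cmod_div by exact Hy. apply Rle_div_l; [now apply Cmod_gt_0 | exact H].
Qed.

Lemma schwarz_lemma (w : C -> C) :
  taylor2_on_disk w -> w 0 = 0 -> (forall z, unit_disk z -> Cmod (w z) <= 1) ->
  forall z, unit_disk z -> Cmod (w z) <= Cmod z.
Proof.
intros Hw H0 Hb z Hz. unfold unit_disk in Hz.
destruct (Ceq_dec z 0) as [->|Nz]; [rewrite H0; lra|].
assert (Pz := proj1 (Cmod_gt_0 z) Nz).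
apply (le_of_scaled_le _ _ (Cmod z) Hz). intros r [Hr1 Hr2].
assert (Hmax : Cmod (w z / z) <= / r).
{ apply (punctured_max_modulus (fun x => w x / x)%C r).
  - lra.
  - apply Rinv_0_lt_compat; lra.
  - intros x Hx Hxr. destruct (Hw x ltac:(unfold unit_disk; lra)) as [A [B [D T]]].
    do 3 eexists. exact (taylor2_mult _ _ _ _ _ _ _ _ _ T (taylor2_inv x Hx)).
  - destruct (Hw 0) as [A [B [D T]]]; [unfold unit_disk; rewrite Cmod_0; lra|].
    assert (EA := taylor2_value _ _ _ _ _ T). rewrite H0 in EA. subst A.
    destruct (taylor2_lip _ _ _ _ _ T) as [s [[K [d [Hd HK]]] E]].
    apply (lb_punctured _ K d Hd). intros h Nh Hh. apply Cdiv_bound; [exact Nh|].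
    specialize (E h). replace (0 + h)%C with h in E by ring.
    replace (w h) with (s h * h)%C by (rewrite E; ring). rewrite Cmod_mult.
    apply Rmult_le_compat_r; [apply Cmod_ge_0 | now apply HK].
  - intros x Hx. apply Cdiv_bound; [apply Cmod_gt_0; lra|].
    rewrite Hx. replace (/ r * r) with 1 by (field; lra). apply Hb. unfold unit_disk; lra.
  - exact Nz.
  - lra. }
rewrite Cmod_div in Hmax by exact Nz.
apply Rle_div_l in Hmax; [|exact Pz].
apply (Rmult_le_compat_l r) in Hmax; [|lra].
replace (r * (/ r * Cmod z)) with (Cmod z) in Hmax by (field; lra). exact Hmax.
Qed.

(** For small real t, w(t)/t = c1 + O(t) has modulus at most 1. *)
Lemma schwarz_coeff1 (w : C -> C) (c1 c2 : C) :
  (forall z, unit_disk z -> Cmod (w z) <= Cmod z) -> taylor2 w 0 0 c1 c2 -> Cmod c1 <= 1.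
Proof.
intros Hw [r [Hr H]]. apply Rle_plus_epsilon. intros e He.
destruct (lb_small (fun h => c2 + h * r h)%C e) as [d [Hd Hs]]; [lb | exact He|].
set (t := Rmin d 1 / 2).
assert (Ht : 0 < t /\ t < d /\ t < 1).
{ assert (X := Rmin_l d 1). assert (X' := Rmin_r d 1).
  assert (X'' : 0 < Rmin d 1) by (apply Rmin_pos; lra). unfold t. lra. }
assert (Et : Cmod (RtoC t) = t) by (rewrite Cmod_R, Rabs_pos_eq; lra).
assert (L := Hw (RtoC t) ltac:(unfold unit_disk; lra)).
specialize (H (RtoC t)). replace (0 + t)%C with (RtoC t) in H by ring.
replace (0 + c1 * t + c2 * t ^ 2 + t ^ 3 * r t)%C
  with ((c1 + t * (c2 + t * r t)) * t)%C in H by ring.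
rewrite H, Cmod_mult, Et in L.
specialize (Hs (RtoC t) ltac:(lra)). simpl in Hs.
assert (G := Cmod_plus_ge c1 (t * (c2 + t * r t))).
assert (Cmod (c1 + t * (c2 + t * r t)) <= 1) by (apply (Rmult_le_reg_r t); lra). lra.
Qed.

(** Schwarz's argument for the Moebius transform of g = w/z that sends c1 to 0, followed by
    comparison of first-order terms at 0. [schwarz_lemma] does not apply: it wants [taylor2] of g at
    0, one order more than w provides. So the punctured principle is applied to the transform
    divided by x. *)
Lemma pick_coeff2_strict (w : C -> C) (c1 c2 : C) :
  taylor2_on_disk w -> (forall z, unit_disk z -> Cmod (w z) <= Cmod z) ->
  taylor2 w 0 0 c1 c2 -> Cmod c1 < 1 -> Cmod c2 <= 1 - Cmod c1 ^ 2.
Proof.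
intros Hw Hb T0 Hc1.
pose (g := fun x => (w x * / x)%C).
pose (q := fun x => ((g x - c1) * / ((1 - Cconj c1 * g x) * x))%C).
assert (Hg : forall x : C, x <> 0 -> Cmod x < 1 -> Cmod (g x) <= 1).
{ intros x Nx Hx. apply Cdiv_bound; [exact Nx|]. rewrite Rmult_1_l. now apply Hb. }
assert (Hden : forall x : C, x <> 0 -> Cmod x < 1 -> 1 - Cmod c1 <= Cmod (1 - Cconj c1 * g x)).
{ intros x Nx Hx. assert (G := Cmod_minus_ge 1 (Cconj c1 * g x)).
  rewrite Cmod_mult, Cmod_conj, Cmod_1 in G. assert (X := Hg x Nx Hx).
  assert (X1 := Cmod_ge_0 c1). nra. }
assert (Hgt : forall x : C, x <> 0 -> Cmod x < 1 -> exists A B D, taylor2 g x A B D).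
{ intros x Nx Hx. destruct (Hw x Hx) as [A [B [D T]]].
  do 3 eexists. exact (taylor2_mult _ _ _ _ _ _ _ _ _ T (taylor2_inv x Nx)). }
assert (Hden0 : forall x : C, x <> 0 -> Cmod x < 1 -> ((1 - Cconj c1 * g x) * x)%C <> 0).
{ intros x Nx Hx. apply Cmult_neq_0; [|exact Nx]. apply Cmod_gt_0.
  assert (X := Hden x Nx Hx). lra. }
destruct T0 as [r [Hr H]].
assert (Eg : forall h : C, h <> 0 -> g h = (c1 + h * (c2 + h * r h))%C).
{ intros h Nh. specialize (H h). replace (0 + h)%C with h in H by ring.
  unfold g. rewrite H. field. exact Nh. }
assert (Hsp : forall z : C, z <> 0 -> Cmod z < 1 ->
  Cmod (g z - c1) <= Cmod z * Cmod (1 - Cconj c1 * g z)).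
{ intros z Nz Hz. assert (Pz := proj1 (Cmod_gt_0 z) Nz).
  apply (le_of_scaled_le _ _ (Cmod z) Hz). intros s [Hs1 Hs2].
  assert (Hmax : Cmod (q z) <= / s).
  { apply (punctured_max_modulus q s); try lra; try exact Nz.
    - apply Rinv_0_lt_compat; lra.
    - intros x Nx Hx. destruct (Hgt x Nx ltac:(lra)) as [A [B [D T]]].
      assert (EA := taylor2_value _ _ _ _ _ T).
      do 3 eexists. apply taylor2_mult.
      + apply taylor2_plus; [exact T | apply (taylor2_const (- c1)%C)].
      + apply (taylor2_Cinv (fun x => ((1 - Cconj c1 * g x) * x)%C)).
        * apply taylor2_mult; [|apply taylor2_id].
          apply (taylor2_ext (fun x => (1 + - Cconj c1 * g x)%C)); [intros; ring|].
          apply taylor2_plus; [apply taylor2_const|].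
          apply taylor2_mult; [apply taylor2_const | exact T].
        * rewrite <- EA. replace (1 + - Cconj c1 * g x)%C with (1 - Cconj c1 * g x)%C by ring.
          apply Hden0; [exact Nx | lra].
    - destruct (lb_plus (fun _ => c2) (fun h => h * r h)%C) as [K [d [Hd HK]]]; [lb | lb |].
      apply (lb_punctured _ (K / (1 - Cmod c1)) (Rmin d 1)); [apply Rmin_pos; lra|].
      intros h Nh Hh.
      assert (h1 : Cmod h < d) by (eapply Rlt_le_trans; [exact Hh | apply Rmin_l]).
      assert (h2 : Cmod h < 1) by (eapply Rlt_le_trans; [exact Hh | apply Rmin_r]).
      apply Cdiv_bound; [now apply Hden0|].
      replace (g h - c1)%C with ((c2 + h * r h) * h)%C by (rewrite (Eg h Nh); ring).
      rewrite !Cmod_mult, <- Rmult_assoc. apply Rmult_le_compat_r; [apply Cmod_ge_0|].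
      specialize (HK h h1). assert (X := Hden h Nh h2).
      assert (X2 := Cmod_ge_0 (c2 + h * r h)).
      apply Rle_trans with (K / (1 - Cmod c1) * (1 - Cmod c1)).
      + replace (K / (1 - Cmod c1) * (1 - Cmod c1)) with K by (field; lra). exact HK.
      + apply Rmult_le_compat_l; [apply Rdiv_le_0_compat; lra | exact X].
    - intros x Hx. assert (Nx : x <> 0) by (apply Cmod_gt_0; lra).
      apply Cdiv_bound; [apply Hden0; [exact Nx | lra]|].
      rewrite Cmod_mult, Hx.
      replace (/ s * (Cmod (1 - Cconj c1 * g x) * s)) with (Cmod (1 - Cconj c1 * g x)) by (field; lra).
      apply mobius_bound; [apply Hg; [exact Nx | lra] | lra]. }
  unfold q in Hmax. change (Cmod ((g z - c1) / ((1 - Cconj c1 * g z) * z)) <= / s) in Hmax.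
  rewrite Cmod_div in Hmax by now apply Hden0.
  apply Rle_div_l in Hmax; [|now apply Cmod_gt_0, Hden0].
  rewrite Cmod_mult in Hmax. apply (Rmult_le_compat_l s) in Hmax; [|lra].
  replace (s * (/ s * (Cmod (1 - Cconj c1 * g z) * Cmod z)))
    with (Cmod z * Cmod (1 - Cconj c1 * g z)) in Hmax by (field; lra). exact Hmax. }
apply Rle_plus_epsilon. intros e He.
destruct (lb_small r (e / 2) Hr ltac:(lra)) as [d1 [Hd1 S1]].
destruct (lb_small (fun h => Cconj c1 * (c2 + h * r h))%C (e / 2)) as [d2 [Hd2 S2]]; [lb | lra |].
set (t := Rmin 1 (Rmin d1 d2) / 2).
assert (Ht : 0 < t /\ t < d1 /\ t < d2 /\ t < 1).
{ assert (X := Rmin_l 1 (Rmin d1 d2)). assert (X' := Rmin_r 1 (Rmin d1 d2)).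
  assert (Y := Rmin_l d1 d2). assert (Y' := Rmin_r d1 d2).
  assert (X'' : 0 < Rmin 1 (Rmin d1 d2)) by (repeat apply Rmin_pos; lra). unfold t. lra. }
clearbody t.
assert (Et : Cmod (RtoC t) = t) by (rewrite Cmod_R, Rabs_pos_eq; lra).
assert (Nt : RtoC t <> 0) by (apply Cmod_gt_0; lra).
assert (L := Hsp _ Nt ltac:(lra)). rewrite (Eg _ Nt), Et in L.
replace (c1 + t * (c2 + t * r t) - c1)%C with (t * (c2 + t * r t))%C in L by ring.
rewrite Cmod_mult, Et in L.
apply Rmult_le_reg_l in L; [|lra].
specialize (S1 (RtoC t) ltac:(lra)). specialize (S2 (RtoC t) ltac:(lra)). simpl in S2.
assert (G := Cmod_plus_ge c2 (t * r t)).
assert (E1 : (1 - Cconj c1 * (c1 + t * (c2 + t * r t)))%C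
  = (RtoC (1 - Cmod c1 ^ 2) - t * (Cconj c1 * (c2 + t * r t)))%C).
{ rewrite RtoC_minus, Cmod2_conj. ring. }
rewrite E1 in L.
assert (G2 := Cmod_triangle (RtoC (1 - Cmod c1 ^ 2)) (- (t * (Cconj c1 * (c2 + t * r t))))).
rewrite Cmod_opp, Cmod_R, Rabs_pos_eq in G2 by (assert (X := Cmod_ge_0 c1); nra).
change (RtoC (1 - Cmod c1 ^ 2) + - (t * (Cconj c1 * (c2 + t * r t))))%C
  with (RtoC (1 - Cmod c1 ^ 2) - (t * (Cconj c1 * (c2 + t * r t))))%C in G2.
lra.
Qed.

(* When |c1| = 1 the Moebius transform degenerates; scaling w by s < 1 avoids this. *)
Lemma pick_coeff2 (w : C -> C) (c1 c2 : C) :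
  taylor2_on_disk w -> (forall z, unit_disk z -> Cmod (w z) <= Cmod z) ->
  taylor2 w 0 0 c1 c2 -> Cmod c2 <= 1 - Cmod c1 ^ 2.
Proof.
intros Hw Hb T.
assert (Hc1 := schwarz_coeff1 w c1 c2 Hb T). assert (P1 := Cmod_ge_0 c1).
(* Scaling gives s|c2| <= 1 - s^2 |c1|^2, which exceeds 1 - |c1|^2 by at most 1 - s^2 <= 2(1 - s);
   the added 2 absorbs this. *)
cut (Cmod c2 + 2 <= 1 - Cmod c1 ^ 2 + 2); [lra|].
apply (le_of_scaled_le _ _ 0 Rlt_0_1). intros s Hs.
assert (Es : Cmod (RtoC s) = s) by (rewrite Cmod_R, Rabs_pos_eq; lra).
assert (H : Cmod (s * c2) <= 1 - Cmod (s * c1) ^ 2).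
{ apply (pick_coeff2_strict (fun x => s * w x)%C).
  - intros x Hx. destruct (Hw x Hx) as [A [B [D Tx]]].
    do 3 eexists. exact (taylor2_mult _ _ _ _ _ _ _ _ _ (taylor2_const s x) Tx).
  - intros z Hz. rewrite Cmod_mult, Es. specialize (Hb z Hz).
    assert (X := Cmod_ge_0 (w z)). nra.
  - assert (X := taylor2_mult _ _ _ _ _ _ _ _ _ (taylor2_const s 0) T).
    replace (s * 0)%C with (RtoC 0) in X by ring.
    replace (s * c1 + 0 * 0)%C with (s * c1)%C in X by ring.
    replace (s * c2 + 0 * c1 + 0 * 0)%C with (s * c2)%C in X by ring. exact X.
  - rewrite Cmod_mult, Es. nra. }
rewrite !Cmod_mult, Es in H.
assert (X1 : Cmod c1 ^ 2 <= 1) by nra.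
assert (X2 : Cmod c1 ^ 2 * (1 - s ^ 2) <= 1 * (1 - s ^ 2)) by (apply Rmult_le_compat_r; nra). nra.
Qed.

(** * Complex power series *)

Definition csum (u : nat -> C) (l : C) : Prop :=
  is_series (K := C_AbsRing) (V := C_NormedModule) u l.

(** A concrete form of [sum_n] that reduces under [simpl] and exposes its terms to [ring]. *)
Fixpoint partial_csum (u : nat -> C) (n : nat) : C :=
  match n with
  | O => u O
  | S m => (partial_csum u m + u (S m))%C
  end.

Lemma partial_csum_sum_n (u : nat -> C) (n : nat) :
  partial_csum u n = sum_n (G := C_AbelianMonoid) u n.
Proof.
induction n as [|n IH]; simpl; [now rewrite sum_O | now rewrite sum_Sn, IH].
Qed.

Lemma csum_iff (u : nat -> C) (l : C) :
  csum u l <-> is_lim_seq (fun n => Cmod (partial_csum u n - l)) 0.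
Proof.
split.
- intros H. apply is_lim_seq_spec. intros eps.
  assert (X := proj1 (filterlim_locally_ball_norm (K := C_AbsRing) (U := C_NormedModule) _ _) H eps).
  destruct X as [N HN]. exists N. intros n Hn. specialize (HN n Hn).
  unfold ball_norm in HN. rewrite <- partial_csum_sum_n in HN.
  rewrite Rminus_0_r, Rabs_pos_eq by apply Cmod_ge_0. exact HN.
- intros H. apply (filterlim_locally_ball_norm (K := C_AbsRing) (U := C_NormedModule)).
  intros eps. apply is_lim_seq_spec in H. destruct (H eps) as [N HN]. exists N.
  intros n Hn. specialize (HN n Hn).
  rewrite Rminus_0_r, Rabs_pos_eq in HN by apply Cmod_ge_0.
  unfold ball_norm. rewrite <- partial_csum_sum_n. exact HN.
Qed.

Lemma csum_unique (u : nat -> C) (l l' : C) : csum u l -> csum u l' -> l = l'.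
Proof.
intros H H'. apply (filterlim_locally_unique (K := C_AbsRing) (V := C_NormedModule) _ _ _ H H').
Qed.

Lemma csum_ext (u v : nat -> C) (l : C) : (forall n, u n = v n) -> csum u l -> csum v l.
Proof. intros E. now apply is_series_ext. Qed.

Lemma csum_plus (u v : nat -> C) (l m : C) :
  csum u l -> csum v m -> csum (fun n => u n + v n)%C (l + m)%C.
Proof. intros H H'. exact (is_series_plus _ _ _ _ H H'). Qed.

Lemma csum_scal (c : C) (u : nat -> C) (l : C) :
  csum u l -> csum (fun n => c * u n)%C (c * l)%C.
Proof. intros H. exact (is_series_scal c _ _ H). Qed.

Lemma csum_shift (u : nat -> C) (l : C) : csum u l -> csum (fun n => u (S n)) (l - u O)%C.
Proof.
intros H. apply is_series_incr_1.
change (csum u ((l - u O) + u O)%C). now replace (l - u O + u O)%C with l by ring.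
Qed.

Lemma csum_unshift (u : nat -> C) (l : C) : csum (fun n => u (S n)) l -> csum u (u O + l)%C.
Proof.
intros H. apply is_series_decr_1.
change (csum (fun n => u (S n)) ((u O + l) - u O)%C).
now replace (u O + l - u O)%C with l by ring.
Qed.

Lemma csum_exists (u : nat -> C) (v : nat -> R) :
  (forall n, Cmod (u n) <= v n) -> ex_series v -> exists l, csum u l.
Proof.
intros H Hv.
exact (ex_series_le (K := C_AbsRing) (V := C_CompleteNormedModule) u v H Hv).
Qed.

Lemma csum_bound (u : nat -> C) (v : nat -> R) (l : C) (L : R) :
  csum u l -> (forall n, Cmod (u n) <= v n) -> is_series v L -> Cmod l <= L.
Proof.
intros Hu H Hv. apply Rle_plus_epsilon. intros e He.
apply csum_iff, is_lim_seq_spec in Hu. destruct (Hu (mkposreal e He)) as [N HN].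
specialize (HN N (Nat.le_refl N)). simpl in HN.
rewrite Rminus_0_r, Rabs_pos_eq in HN by apply Cmod_ge_0.
assert (Hp : Cmod (partial_csum u N) <= sum_n v N).
{ clear HN. induction N as [|N IH]; simpl; [rewrite sum_O; apply H|].
  rewrite sum_Sn. eapply Rle_trans; [apply Cmod_triangle|].
  apply Rplus_le_compat; [exact IH | apply H]. }
assert (Hs : sum_n v N <= L).
{ apply (is_lim_seq_incr_compare (sum_n v)); [exact Hv|]. intros n. rewrite sum_Sn.
  assert (0 <= v (S n)) by (eapply Rle_trans; [apply Cmod_ge_0 | apply H]).
  change (sum_n v n <= sum_n v n + v (S n)). lra. }
assert (G := Cmod_minus_ge l (partial_csum u N)). rewrite Cmod_minus_sym in G. lra.
Qed.

Lemma Series_scal_geom (K q : R) :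
  0 <= q < 1 -> is_series (fun n => K * q ^ n) (K * / (1 - q)).
Proof.
intros Hq. apply (is_series_scal (K := R_AbsRing) (V := R_NormedModule) K).
apply is_series_geom. rewrite Rabs_pos_eq; lra.
Qed.

(* Equivalently, the power series with coefficients b converges in the open unit disk. *)
Definition disk_seq (b : nat -> C) : Prop :=
  forall r, 0 < r < 1 -> exists K, forall n, Cmod (b n) * r ^ n <= K.

Definition is_ps (b : nat -> C) (P : C -> C) : Prop :=
  disk_seq b /\ forall z, unit_disk z -> csum (fun n => b n * z ^ n)%C (P z).

Lemma disk_seq_geom (b : nat -> C) (r : R) :
  disk_seq b -> 0 <= r < 1 ->
  exists K q, 0 <= K /\ 0 < q < 1 /\ forall n, Cmod (b n) * r ^ n <= K * q ^ n.
Proof.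
(* The intermediate radius s keeps the ratio q positive even for r = 0. *)
intros Hb Hr. pose (s := (1 + r) / 2). assert (Hs : 0 < s < 1) by (unfold s; lra).
assert (Hs' : 0 < (1 + s) / 2 < 1) by lra.
destruct (Hb _ Hs') as [K HK]. exists K, (s / ((1 + s) / 2)).
assert (HK0 : 0 <= K).
{ specialize (HK O). simpl in HK. assert (X := Cmod_ge_0 (b O)). lra. }
split; [exact HK0|]. split.
- split; [apply Rdiv_lt_0_compat; lra | apply Rlt_div_l; lra].
- intros n. apply Rle_trans with (Cmod (b n) * s ^ n).
  + apply Rmult_le_compat_l; [apply Cmod_ge_0|]. apply pow_incr. unfold s; lra.
  + unfold Rdiv. rewrite Rpow_mult_distr, pow_inv.
    assert (Hp : 0 < ((1 + s) * / 2) ^ n) by (apply pow_lt; lra).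
    replace (K * (s ^ n * / ((1 + s) * / 2) ^ n)) with (K / ((1 + s) * / 2) ^ n * s ^ n)
      by (unfold Rdiv; ring).
    apply Rmult_le_compat_r; [apply pow_le; lra|].
    apply Rle_div_r; [exact Hp | apply HK].
Qed.

Lemma disk_seq_intro (b : nat -> C) (K : R) : (forall n, Cmod (b n) <= K) -> disk_seq b.
Proof.
intros H r Hr. exists K. intros n. assert (X := H n). assert (Y := Cmod_ge_0 (b n)).
assert (Hp : 0 <= r ^ n <= 1).
{ split; [apply pow_le; lra|]. rewrite <- (pow1 n). apply pow_incr; lra. }
nra.
Qed.

Lemma disk_seq_plus (a b : nat -> C) :
  disk_seq a -> disk_seq b -> disk_seq (fun n => a n + b n)%C.
Proof.
intros Ha Hb r Hr. destruct (Ha r Hr) as [K HK], (Hb r Hr) as [K' HK'].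
exists (K + K'). intros n. specialize (HK n). specialize (HK' n).
assert (X := Cmod_triangle (a n) (b n)).
assert (Y : 0 <= r ^ n) by (apply pow_le; lra). nra.
Qed.

Lemma disk_seq_scal (c : C) (b : nat -> C) : disk_seq b -> disk_seq (fun n => c * b n)%C.
Proof.
intros Hb r Hr. destruct (Hb r Hr) as [K HK]. exists (Cmod c * K). intros n.
rewrite Cmod_mult, Rmult_assoc. apply Rmult_le_compat_l; [apply Cmod_ge_0 | apply HK].
Qed.

Lemma disk_seq_abs (b : nat -> C) (z : C) :
  disk_seq b -> unit_disk z -> ex_series (fun n => Cmod (b n * z ^ n)).
Proof.
intros Hb Hz. destruct (disk_seq_geom b (Cmod z) Hb) as [K [q [HK [Hq H]]]].
{ split; [apply Cmod_ge_0 | exact Hz]. }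
apply (ex_series_le (K := R_AbsRing) (V := R_CompleteNormedModule) _ (fun n => K * q ^ n)).
- intros n. change (Rabs (Cmod (b n * z ^ n)) <= K * q ^ n).
  rewrite Rabs_pos_eq by apply Cmod_ge_0. rewrite Cmod_mult, Cmod_pow. apply H.
- exists (K * / (1 - q)). apply Series_scal_geom. lra.
Qed.

Lemma ps_exists (b : nat -> C) : disk_seq b -> exists P, is_ps b P.
Proof.
intros Hb.
assert (H : forall z, exists l, unit_disk z -> csum (fun n => b n * z ^ n)%C l).
{ intros z. destruct (Rlt_dec (Cmod z) 1) as [Hz|N].
  - destruct (csum_exists (fun n => b n * z ^ n)%C (fun n => Cmod (b n * z ^ n))) as [l Hl].
    + intros n; lra.
    + now apply disk_seq_abs.
    + now exists l.
  - exists (RtoC 0). intros Hz. contradiction. }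
exists (fun z => proj1_sig (constructive_indefinite_description _ (H z))).
split; [exact Hb|]. intros z Hz.
exact (proj2_sig (constructive_indefinite_description _ (H z)) Hz).
Qed.

Lemma ps_bounded (b : nat -> C) (P : C -> C) (r : R) :
  is_ps b P -> 0 <= r < 1 -> exists M, forall z, Cmod z <= r -> Cmod (P z) <= M.
Proof.
intros [Hb HP] Hr. destruct (disk_seq_geom b r Hb Hr) as [K [q [HK [Hq H]]]].
exists (K * / (1 - q)). intros z Hz.
apply (csum_bound _ (fun n => K * q ^ n) _ _ (HP z ltac:(unfold unit_disk; lra)));
  [|apply Series_scal_geom; lra].
intros n. eapply Rle_trans; [|apply H]. rewrite Cmod_mult, Cmod_pow.
apply Rmult_le_compat_l; [apply Cmod_ge_0|]. apply pow_incr. split; [apply Cmod_ge_0 | exact Hz].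
Qed.

Lemma ps_ext (b : nat -> C) (P Q : C -> C) :
  (forall z, unit_disk z -> P z = Q z) -> is_ps b P -> is_ps b Q.
Proof. intros E [Hb H]. split; [exact Hb|]. intros z Hz. rewrite <- E by exact Hz. now apply H. Qed.

Lemma ps_plus (a b : nat -> C) (P Q : C -> C) :
  is_ps a P -> is_ps b Q -> is_ps (fun n => a n + b n)%C (fun z => P z + Q z)%C.
Proof.
intros [Ha H] [Hb H']. split; [now apply disk_seq_plus|]. intros z Hz.
eapply csum_ext; [|exact (csum_plus _ _ _ _ (H z Hz) (H' z Hz))]. intros n; simpl; ring.
Qed.

Lemma ps_scal (c : C) (b : nat -> C) (P : C -> C) :
  is_ps b P -> is_ps (fun n => c * b n)%C (fun z => c * P z)%C.
Proof.
intros [Hb H]. split; [now apply disk_seq_scal|]. intros z Hz.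
eapply csum_ext; [|exact (csum_scal c _ _ (H z Hz))]. intros n; simpl; ring.
Qed.

Lemma unit_disk_0 : unit_disk 0.
Proof. unfold unit_disk. rewrite Cmod_0. lra. Qed.

Lemma csum_power_0 (b : nat -> C) (l : C) : csum (fun n => b n * 0 ^ n)%C l -> l = b O.
Proof.
intros H. refine (csum_unique _ _ _ H _).
replace (b O) with (b O * 0 ^ 0 + 0 * 0)%C by (simpl; ring).
apply (csum_unshift (fun n => b n * 0 ^ n)%C).
apply (csum_ext (fun n => 0 * (0 * 0 ^ n))%C); [intros; simpl; ring|].
apply csum_scal. apply csum_iff.
apply (is_lim_seq_ext (fun _ => 0)); [|apply is_lim_seq_const]. intros n.
replace (partial_csum (fun n => 0 * 0 ^ n)%C n) with (RtoC 0).
- replace (0 - 0)%C with (RtoC 0) by ring. now rewrite Cmod_0.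
- induction n as [|n IH]; simpl; [ring | rewrite <- IH; ring].
Qed.

Lemma ps_value_0 (b : nat -> C) (P : C -> C) : is_ps b P -> P 0 = b O.
Proof. intros [_ H]. apply csum_power_0, H, unit_disk_0. Qed.

(* The quotient (P z - P z0) / (z - z0) is a power series whose coefficients are the
   tails of P at z0 divided by powers of z0. *)
Lemma ps_divide (b : nat -> C) (P : C -> C) (z0 : C) :
  is_ps b P -> unit_disk z0 ->
  exists c Q, is_ps c Q /\ (forall z, unit_disk z -> P z = P z0 + (z - z0) * Q z)%C /\
    (forall k, c k = b (S k) + z0 * c (S k))%C.
Proof.
intros [Hb HP] Hz0.
(* The bound is kept for every s > |z0|, because [disk_seq c] later needs s close to 1 for tails
   already chosen. *)
assert (Hc : forall k, exists l, csum (fun m => b (S k + m)%nat * z0 ^ m)%C l /\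
  forall s K, Cmod z0 < s -> (forall n, Cmod (b n) * s ^ n <= K) ->
    Cmod l <= K / s ^ S k * / (1 - Cmod z0 / s)).
{ intros k.
  assert (Hbd : forall s K, Cmod z0 < s -> (forall n, Cmod (b n) * s ^ n <= K) ->
    0 <= Cmod z0 / s < 1 /\
    forall m, Cmod (b (S k + m)%nat * z0 ^ m) <= K / s ^ S k * (Cmod z0 / s) ^ m).
  { intros s K Hs HK. assert (X := Cmod_ge_0 z0).
    split; [split; [apply Rdiv_le_0_compat; lra | apply Rlt_div_l; lra]|].
    intros m. rewrite Cmod_mult, Cmod_pow. unfold Rdiv at 2. rewrite Rpow_mult_distr, pow_inv.
    replace (K / s ^ S k * (Cmod z0 ^ m * / s ^ m)) with (K / s ^ (S k + m) * Cmod z0 ^ m)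
      by (rewrite pow_add; field; repeat split; try apply pow_nonzero; lra).
    apply Rmult_le_compat_r; [now apply pow_le|].
    apply Rle_div_r; [apply pow_lt; lra | apply HK]. }
  assert (Hs : 0 < (1 + Cmod z0) / 2 < 1)
    by (assert (X := Cmod_ge_0 z0); unfold unit_disk in Hz0; lra).
  destruct (Hb _ Hs) as [K HK].
  destruct (Hbd ((1 + Cmod z0) / 2) K ltac:(unfold unit_disk in Hz0; lra) HK) as [Hq Hm].
  destruct (csum_exists _ _ Hm) as [l Hl].
  { eexists. now apply Series_scal_geom. }
  exists l. split; [exact Hl|]. intros s K' Hs' HK'.
  destruct (Hbd s K' Hs' HK') as [Hq' Hm'].
  exact (csum_bound _ _ _ _ Hl Hm' (Series_scal_geom _ _ Hq')). }
pose (c := fun k => proj1_sig (constructive_indefinite_description _ (Hc k))).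
assert (Hcs : forall k, csum (fun m => b (S k + m)%nat * z0 ^ m)%C (c k) /\
  forall s K, Cmod z0 < s -> (forall n, Cmod (b n) * s ^ n <= K) ->
    Cmod (c k) <= K / s ^ S k * / (1 - Cmod z0 / s)).
{ intros k. exact (proj2_sig (constructive_indefinite_description _ (Hc k))). }
clearbody c.
assert (Hrec : forall k, c k = (b (S k) + z0 * c (S k))%C).
{ intros k. apply (csum_unique _ _ _ (proj1 (Hcs k))).
  replace (b (S k)) with (b (S k + 0)%nat * z0 ^ 0)%C by (rewrite Nat.add_0_r; simpl; ring).
  apply (csum_unshift (fun m => b (S k + m)%nat * z0 ^ m)%C).
  eapply csum_ext; [|exact (csum_scal z0 _ _ (proj1 (Hcs (S k))))].
  intros n. simpl. rewrite Nat.add_succ_r. ring. }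
assert (HP0 : P z0 = (b O + z0 * c O)%C).
{ apply (csum_unique _ _ _ (HP z0 Hz0)).
  replace (b O) with (b O * z0 ^ 0)%C by (simpl; ring).
  apply (csum_unshift (fun m => b m * z0 ^ m)%C).
  eapply csum_ext; [|exact (csum_scal z0 _ _ (proj1 (Hcs O)))].
  intros n. simpl. ring. }
assert (Hcd : disk_seq c).
{ intros r Hr. assert (X0 := Cmod_ge_0 z0).
  set (s := Rmax r ((1 + Cmod z0) / 2)).
  assert (S1 : r <= s) by apply Rmax_l.
  assert (S2 : Cmod z0 < s).
  { apply Rlt_le_trans with ((1 + Cmod z0) / 2); [unfold unit_disk in Hz0; lra | apply Rmax_r]. }
  assert (S3 : s < 1) by (apply Rmax_lub_lt; unfold unit_disk in Hz0; lra).
  destruct (Hb s ltac:(lra)) as [K HK].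
  assert (HK0 : 0 <= K).
  { specialize (HK O). simpl in HK. assert (X := Cmod_ge_0 (b O)). lra. }
  assert (Hq : 0 < 1 - Cmod z0 / s).
  { assert (Cmod z0 / s < 1) by (apply Rlt_div_l; lra). lra. }
  exists (K / s * / (1 - Cmod z0 / s)). intros k.
  assert (HC := proj2 (Hcs k) s K S2 HK).
  assert (Hp : 0 < s ^ k) by (apply pow_lt; lra).
  apply Rle_trans with (K / s ^ S k * / (1 - Cmod z0 / s) * s ^ k).
  - apply Rmult_le_compat; [apply Cmod_ge_0 | apply pow_le; lra | exact HC|].
    apply pow_incr; lra.
  - right. simpl. field. repeat split; lra. }
destruct (ps_exists c Hcd) as [Q HQ]. exists c, Q. split; [exact HQ|]. split; [|exact Hrec].
intros z Hz.
(* Beyond the constant term, (z - z0) Q(z) has coefficients c_n - z0 c_(n+1), which are b_(n+1) by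
   [Hrec]. *)
assert (H1 := csum_shift _ _ (HP z Hz)).
assert (H2 := csum_shift _ _ (proj2 HQ z Hz)).
assert (H3 := csum_plus _ _ _ _ (csum_scal z _ _ (proj2 HQ z Hz)) (csum_scal (- z0) _ _ H2)).
assert (E : (P z - b O * z ^ 0)%C = (z * Q z + - z0 * (Q z - c O * z ^ 0))%C).
{ apply (csum_unique _ _ _ H1). eapply csum_ext; [|exact H3].
  intros n. simpl. rewrite (Hrec n). ring. }
replace (P z) with (P z - b O * z ^ 0 + b O)%C by (simpl; ring).
rewrite E, HP0. simpl. ring.
Qed.

(** Three successive divisions give the two coefficients and, as the last quotient, a remainder
    factor that is bounded near z. *)
Lemma ps_taylor2 (b : nat -> C) (P : C -> C) (z : C) :
  is_ps b P -> unit_disk z -> exists B D, taylor2 P z (P z) B D.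
Proof.
intros HP Hz. destruct (ps_divide b P z HP Hz) as [c [Q [HQ [EQ _]]]].
destruct (ps_divide c Q z HQ Hz) as [c' [Q' [HQ' [EQ' _]]]].
destruct (ps_divide c' Q' z HQ' Hz) as [c3 [Q3 [HQ3 [EQ3 _]]]].
exists (Q z), (Q' z).
assert (Hd : 0 < (1 - Cmod z) / 2) by (unfold unit_disk in Hz; lra).
apply (taylor2_intro _ _ _ _ _ _ (fun h => Q3 (z + h)%C) Hd).
- destruct (ps_bounded c3 Q3 ((1 + Cmod z) / 2) HQ3) as [M HM].
  { assert (X := Cmod_ge_0 z). lra. }
  exists M, ((1 - Cmod z) / 2). split; [exact Hd|]. intros h Hh. apply HM.
  eapply Rle_trans; [apply Cmod_triangle|]. lra.
- intros h Hh.
  assert (Hzh : unit_disk (z + h)%C).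
  { unfold unit_disk. eapply Rle_lt_trans; [apply Cmod_triangle|]. lra. }
  rewrite EQ, EQ', EQ3 by exact Hzh. ring.
Qed.

Lemma ps_taylor2_0 (b : nat -> C) (P : C -> C) :
  is_ps b P -> taylor2 P 0 (b 0%nat) (b 1%nat) (b 2%nat).
Proof.
intros HP. destruct (ps_divide b P 0 HP unit_disk_0) as [c [Q [HQ [EQ Rc]]]].
destruct (ps_divide c Q 0 HQ unit_disk_0) as [c' [Q' [HQ' [EQ' Rc']]]].
destruct (ps_divide c' Q' 0 HQ' unit_disk_0) as [c3 [Q3 [HQ3 [EQ3 _]]]].
assert (E0 := ps_value_0 _ _ HP). assert (E1 := ps_value_0 _ _ HQ).
assert (E2 := ps_value_0 _ _ HQ').
assert (R1 := Rc 0%nat). assert (R2 := Rc' 0%nat). assert (R3 := Rc 1%nat).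
replace (b 1%nat) with (Q 0) by (rewrite E1, R1; ring).
replace (b 2%nat) with (Q' 0) by (rewrite E2, R2, R3; ring). rewrite <- E0.
apply (taylor2_intro _ _ _ _ _ (1 / 2) Q3); [lra| |].
- destruct (ps_bounded c3 Q3 (1 / 2) HQ3 ltac:(lra)) as [M HM].
  exists M, (1 / 2). split; [lra|]. intros h Hh. apply HM. lra.
- intros h Hh. replace (0 + h)%C with h by ring.
  assert (Hzh : unit_disk h) by (unfold unit_disk; lra).
  rewrite EQ, EQ', EQ3 by exact Hzh. ring.
Qed.

(** Bernoulli's inequality ([poly]) for q = 1/(1 + x): the factor 1 + 1/x turns 1 + n x into at
    least n + 1. *)
Lemma linear_geom_bound (q : R) : 0 < q < 1 -> exists K, forall n, INR (S n) * q ^ n <= K.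
Proof.
intros Hq. set (x := / q - 1).
assert (Hx : 0 < x) by (unfold x; assert (1 < / q) by (rewrite <- Rinv_1; apply Rinv_lt_contravar; lra); lra).
assert (Eq : q = / (1 + x)) by (unfold x; field; lra).
exists (1 + / x). intros n. rewrite Eq, pow_inv.
assert (HB := poly n x Hx). assert (Hp : 0 < (1 + x) ^ n) by (apply pow_lt; lra).
apply Rle_div_l; [exact Hp|]. rewrite S_INR.
assert (Hn := pos_INR n).
assert (0 < / x) by now apply Rinv_0_lt_compat.
apply Rle_trans with ((1 + / x) * (1 + INR n * x)); [|apply Rmult_le_compat_l; lra].
replace ((1 + / x) * (1 + INR n * x)) with (INR n + 1 + / x + INR n * x) by (field; lra).
assert (0 <= INR n * x) by (apply Rmult_le_pos; lra). lra.
Qed.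

Definition derived_seq (b : nat -> C) (n : nat) : C := (INR (S n) * b (S n))%C.

Lemma disk_seq_derived (b : nat -> C) : disk_seq b -> disk_seq (derived_seq b).
Proof.
intros Hb r Hr. destruct (disk_seq_geom b r Hb ltac:(lra)) as [K [q [HK [Hq H]]]].
destruct (linear_geom_bound q Hq) as [L HL].
exists (K * L / r). intros n. unfold derived_seq.
rewrite Cmod_mult, Cmod_R, Rabs_pos_eq by apply pos_INR.
apply (proj1 (Rle_div_r _ _ r (proj1 Hr))). specialize (H (S n)). specialize (HL n).
replace (INR (S n) * Cmod (b (S n)) * r ^ n * r) with (INR (S n) * (Cmod (b (S n)) * r ^ S n))
  by (simpl; ring).
apply Rle_trans with (INR (S n) * (K * q ^ S n)).
- apply Rmult_le_compat_l; [apply pos_INR | exact H].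
- replace (INR (S n) * (K * q ^ S n)) with (K * (INR (S n) * q ^ n * q)) by (simpl; ring).
  apply Rmult_le_compat_l; [exact HK|].
  assert (0 <= INR (S n) * q ^ n) by (apply Rmult_le_pos; [apply pos_INR | apply pow_le; lra]).
  nra.
Qed.

Lemma summation_by_parts (t : nat -> C) (N : nat) :
  partial_csum (fun k => INR (S k) * (t k - t (S k)))%C N
  = (partial_csum t N - INR (S N) * t (S N))%C.
Proof.
induction N as [|N IH].
- simpl. ring.
- change (partial_csum (fun k => INR (S k) * (t k - t (S k)))%C N
    + INR (S (S N)) * (t (S N) - t (S (S N)))
    = partial_csum t N + t (S N) - INR (S (S N)) * t (S (S N)))%C.
  rewrite IH, (S_INR (S N)), RtoC_plus. ring.
Qed.

(* With (P z - P z0) / (z - z0) = sum c_k z^k and t_k = c_k z0^k one has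
   t_k - t_(k+1) = b_(k+1) z0^k, so summation by parts gives the derived series at z0. *)
Lemma ps_derived (b : nat -> C) (P : C -> C) :
  is_ps b P -> exists P', is_ps (derived_seq b) P' /\
    forall z, unit_disk z -> exists D, taylor2 P z (P z) (P' z) D.
Proof.
intros HP. destruct (ps_exists _ (disk_seq_derived b (proj1 HP))) as [P' HP'].
exists P'. split; [exact HP'|]. intros z Hz.
destruct (ps_divide b P z HP Hz) as [c [Q [HQ [EQ Rc]]]].
destruct (ps_taylor2 b P z HP Hz) as [B [D T]]. exists D.
destruct (ps_divide c Q z HQ Hz) as [c' [Q' [HQ' [EQ' _]]]].
(* [ps_taylor2] does not reveal its linear coefficient; an expansion with coefficient Q z identifies
   it by uniqueness. *)
assert (EB : B = Q z).
{ assert (T' : taylor2 P z (P z) (Q z) (Q' z)).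
  { apply (taylor2_ext_loc (fun x => P z + (x - z) * (Q z + (x - z) * (Q' x)))%C _ _ _ _ _ (1 - Cmod z)).
    - unfold unit_disk in Hz; lra.
    - intros h Hh. assert (Hzh : unit_disk (z + h)%C).
      { unfold unit_disk. eapply Rle_lt_trans; [apply Cmod_triangle|]. lra. }
      rewrite <- EQ', <- EQ by exact Hzh. reflexivity.
    - destruct (ps_taylor2 c' Q' z HQ' Hz) as [B' [D' [r [Hr H]]]].
      exists (fun h => B' + D' * h + h ^ 2 * r h)%C. split; [lb|].
      intros h. rewrite H. ring. }
  exact (proj1 (taylor2_unique _ _ _ _ _ _ _ _ T T')). }
subst B. replace (P' z) with (Q z); [exact T|].
apply (csum_unique (fun n => derived_seq b n * z ^ n)%C); [|now apply HP'].
apply csum_iff.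
assert (HQz := proj1 (csum_iff _ _) (proj2 HQ z Hz)).
(* The boundary term of the summation by parts vanishes, being z times a term of the convergent
   derived series of c. *)
assert (Hc0 : is_lim_seq (fun n => Cmod (INR (S n) * (c (S n) * z ^ S n))) 0).
{ assert (X := ex_series_lim_0 _ (disk_seq_abs _ z (disk_seq_derived c (proj1 HQ)) Hz)).
  assert (X2 := is_lim_seq_scal_l _ (Cmod z) _ X). simpl in X2. rewrite Rmult_0_r in X2.
  eapply is_lim_seq_ext; [|exact X2]. intros n. cbv beta. rewrite <- Cmod_mult.
  f_equal. unfold derived_seq. rewrite (Cpow_S z n). ring. }
apply (is_lim_seq_le_le (fun _ => 0) _ (fun n => Cmod (partial_csum (fun n => c n * z ^ n)%C n - Q z)
   + Cmod (INR (S n) * (c (S n) * z ^ S n)))).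
- intros n. split; [apply Cmod_ge_0|].
  replace (partial_csum (fun n => derived_seq b n * z ^ n)%C n)
    with (partial_csum (fun k => INR (S k) * (c k * z ^ k - c (S k) * z ^ S k))%C n).
  + rewrite (summation_by_parts (fun k => c k * z ^ k)%C).
    replace (partial_csum (fun k => c k * z ^ k)%C n - INR (S n) * (c (S n) * z ^ S n) - Q z)%C
      with ((partial_csum (fun k => c k * z ^ k)%C n - Q z) + - (INR (S n) * (c (S n) * z ^ S n)))%C by ring.
    eapply Rle_trans; [apply Cmod_triangle|]. rewrite Cmod_opp. lra.
  + rewrite !partial_csum_sum_n. apply sum_n_ext. intros k. unfold derived_seq.
    rewrite (Rc k), Cpow_S. match goal with |- ?l = ?r => change (@eq C l r) end. ring.
- apply is_lim_seq_const.
- replace (Finite 0) with (Finite (0 + 0)) by (f_equal; ring).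
  apply is_lim_seq_plus'; assumption.
Qed.

(** * The equation y' = R y *)

Lemma Re_partial_csum (u : nat -> C) (n : nat) :
  Re (partial_csum u n) = sum_n (fun k => Re (u k)) n.
Proof.
induction n as [|n IH]; [now rewrite sum_O|]. rewrite sum_Sn, <- IH. reflexivity.
Qed.

Lemma Im_partial_csum (u : nat -> C) (n : nat) :
  Im (partial_csum u n) = sum_n (fun k => Im (u k)) n.
Proof.
induction n as [|n IH]; [now rewrite sum_O|]. rewrite sum_Sn, <- IH. reflexivity.
Qed.

Lemma im_le_Cmod (z : C) : Rabs (Im z) <= Cmod z.
Proof. eapply Rle_trans; [apply Rmax_r | apply Rmax_Cmod]. Qed.

Lemma csum_components (u : nat -> C) (l : C) :
  csum u l <-> is_series (fun n => Re (u n)) (Re l) /\ is_series (fun n => Im (u n)) (Im l).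
Proof.
split.
- intros H. apply csum_iff in H. split.
  + apply (is_lim_seq_ext (fun n => Re (partial_csum u n)) _ (Re l)); [apply Re_partial_csum|].
    apply is_lim_seq_spec. apply is_lim_seq_spec in H. intros eps.
    destruct (H eps) as [N HN]. exists N. intros n Hn. specialize (HN n Hn).
    rewrite Rminus_0_r, Rabs_pos_eq in HN by apply Cmod_ge_0.
    eapply Rle_lt_trans; [|exact HN]. exact (re_le_Cmod (partial_csum u n - l)).
  + apply (is_lim_seq_ext (fun n => Im (partial_csum u n)) _ (Im l)); [apply Im_partial_csum|].
    apply is_lim_seq_spec. apply is_lim_seq_spec in H. intros eps.
    destruct (H eps) as [N HN]. exists N. intros n Hn. specialize (HN n Hn).
    rewrite Rminus_0_r, Rabs_pos_eq in HN by apply Cmod_ge_0.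
    eapply Rle_lt_trans; [|exact HN]. exact (im_le_Cmod (partial_csum u n - l)).
- intros [H1 H2]. apply csum_iff.
  assert (L1 : is_lim_seq (fun n => Re (partial_csum u n)) (Re l)).
  { apply (is_lim_seq_ext (sum_n (fun n => Re (u n)))); [|exact H1].
    intros n. symmetry. apply Re_partial_csum. }
  assert (L2 : is_lim_seq (fun n => Im (partial_csum u n)) (Im l)).
  { apply (is_lim_seq_ext (sum_n (fun n => Im (u n)))); [|exact H2].
    intros n. symmetry. apply Im_partial_csum. }
  apply is_lim_seq_spec in L1. apply is_lim_seq_spec in L2.
  apply is_lim_seq_spec. intros eps.
  destruct (L1 (pos_div_2 eps)) as [N1 HN1], (L2 (pos_div_2 eps)) as [N2 HN2].
  exists (max N1 N2). intros n Hn.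
  specialize (HN1 n ltac:(lia)). specialize (HN2 n ltac:(lia)). simpl in HN1, HN2.
  rewrite Rminus_0_r, Rabs_pos_eq by apply Cmod_ge_0.
  eapply Rle_lt_trans.
  + apply (Cmod_le_Rabs (Re (partial_csum u n) - Re l) (Im (partial_csum u n) - Im l)).
  + lra.
Qed.

Definition cconv (a b : nat -> C) (n : nat) : C :=
  partial_csum (fun k => a k * b (n - k)%nat)%C n.

(** Four real Cauchy products, one for each pairing of real and imaginary parts. *)
Lemma csum_mult (u v : nat -> C) (U V : C) :
  csum u U -> csum v V -> ex_series (fun n => Cmod (u n)) -> ex_series (fun n => Cmod (v n)) ->
  csum (cconv u v) (U * V)%C.
Proof.
intros Hu Hv Au Av. apply csum_components in Hu. apply csum_components in Hv.
destruct Hu as [Hu1 Hu2], Hv as [Hv1 Hv2].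
assert (A : forall w : nat -> C, ex_series (fun n => Cmod (w n)) ->
  ex_series (fun n => Rabs (Re (w n))) /\ ex_series (fun n => Rabs (Im (w n)))).
{ intros w Hw. split.
  - apply (ex_series_le (K := R_AbsRing) (V := R_CompleteNormedModule) _ _
      (fun n => Rle_trans _ _ _ (Req_le _ _ (Rabs_Rabsolu _)) (re_le_Cmod (w n))) Hw).
  - apply (ex_series_le (K := R_AbsRing) (V := R_CompleteNormedModule) _ _
      (fun n => Rle_trans _ _ _ (Req_le _ _ (Rabs_Rabsolu _)) (im_le_Cmod (w n))) Hw). }
destruct (A u Au) as [Au1 Au2], (A v Av) as [Av1 Av2].
apply csum_components. split.
- assert (X := is_series_minus _ _ _ _ (is_series_mult _ _ _ _ Hu1 Hv1 Au1 Av1)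
    (is_series_mult _ _ _ _ Hu2 Hv2 Au2 Av2)).
  eapply is_series_ext; [|exact X]. intros n. unfold cconv. rewrite Re_partial_csum, sum_n_Reals.
  change (sum_f_R0 (fun k => Re (u k) * Re (v (n - k)%nat)) n
    - sum_f_R0 (fun k => Im (u k) * Im (v (n - k)%nat)) n
    = sum_f_R0 (fun k => Re (u k) * Re (v (n - k)%nat) - Im (u k) * Im (v (n - k)%nat)) n).
  now rewrite minus_sum.
- assert (X := is_series_plus _ _ _ _ (is_series_mult _ _ _ _ Hu1 Hv2 Au1 Av2)
    (is_series_mult _ _ _ _ Hu2 Hv1 Au2 Av1)).
  eapply is_series_ext; [|exact X]. intros n. unfold cconv. rewrite Im_partial_csum, sum_n_Reals.
  change (sum_f_R0 (fun k => Re (u k) * Im (v (n - k)%nat)) n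
    + sum_f_R0 (fun k => Im (u k) * Re (v (n - k)%nat)) n
    = sum_f_R0 (fun k => Re (u k) * Im (v (n - k)%nat) + Im (u k) * Re (v (n - k)%nat)) n).
  now rewrite plus_sum.
Qed.

Lemma partial_csum_ext (u v : nat -> C) (n : nat) :
  (forall k, (k <= n)%nat -> u k = v k) -> partial_csum u n = partial_csum v n.
Proof.
induction n as [|n IH]; intros H; simpl; [apply H; lia|].
rewrite IH by (intros; apply H; lia). now rewrite (H (S n)) by lia.
Qed.

Lemma partial_csum_scal (c : C) (u : nat -> C) (n : nat) :
  partial_csum (fun k => c * u k)%C n = (c * partial_csum u n)%C.
Proof. induction n as [|n IH]; simpl; [reflexivity | rewrite IH; ring]. Qed.

Lemma csum_ps_mult (a b : nat -> C) (P Q : C -> C) (z : C) :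
  is_ps a P -> is_ps b Q -> unit_disk z ->
  csum (fun n => cconv a b n * z ^ n)%C (P z * Q z)%C.
Proof.
intros [Ha HP] [Hb HQ] Hz.
eapply csum_ext; [|exact (csum_mult _ _ _ _ (HP z Hz) (HQ z Hz)
  (disk_seq_abs a z Ha Hz) (disk_seq_abs b z Hb Hz))].
intros n. unfold cconv. rewrite (Cmult_comm _ (z ^ n)), <- partial_csum_scal.
apply partial_csum_ext. intros k Hk.
replace (z ^ n)%C with (z ^ k * z ^ (n - k))%C by (rewrite <- Cpow_add_r; f_equal; lia). ring.
Qed.

(** Each coefficient depends on all earlier ones, so the structural recursion returns the whole
    table, correct up to index n. *)
Fixpoint ode_table (rho : nat -> C) (n : nat) : nat -> C :=
  match n with
  | O => fun _ => RtoC 1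
  | S m => fun k => if Nat.eqb k (S m) then (cconv rho (ode_table rho m) m / INR (S m))%C
                    else ode_table rho m k
  end.

(* Coefficients of the solution of y' = R y, y(0) = 1, where R = sum rho_n z^n. *)
Definition ode_seq (rho : nat -> C) (n : nat) : C := ode_table rho n n.

Lemma ode_table_stable (rho : nat -> C) (n k : nat) :
  (k <= n)%nat -> ode_table rho n k = ode_seq rho k.
Proof.
induction n as [|n IH]; intros H.
- now replace k with 0%nat by lia.
- simpl. destruct (Nat.eqb_spec k (S n)) as [->|N].
  + unfold ode_seq. simpl. now rewrite Nat.eqb_refl.
  + apply IH. lia.
Qed.

Lemma RtoC_INR_S_neq_0 (n : nat) : RtoC (INR (S n)) <> 0.
Proof. intros E. apply RtoC_inj in E. revert E. apply not_0_INR. lia. Qed.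

Lemma ode_seq_rec (rho : nat -> C) (n : nat) :
  derived_seq (ode_seq rho) n = cconv rho (ode_seq rho) n.
Proof.
assert (E : ode_seq rho (S n) = (cconv rho (ode_table rho n) n / INR (S n))%C).
{ unfold ode_seq at 1. change (ode_table rho (S n) (S n)) with (if Nat.eqb (S n) (S n)
    then (cconv rho (ode_table rho n) n / INR (S n))%C else ode_table rho n (S n)).
  now rewrite Nat.eqb_refl. }
unfold derived_seq. rewrite E.
replace (cconv rho (ode_table rho n) n) with (cconv rho (ode_seq rho) n).
- field. apply RtoC_INR_S_neq_0.
- apply partial_csum_ext. intros k Hk. now rewrite ode_table_stable by lia.
Qed.

(** With Y_n = |y_n| r^n and partial sums S_n, the recursion gives (n + 1) Y_(n+1) <= K S_n. Hence
    S_(n+1) <= t S_n for large n, whatever t > 1, and such growth is absorbed by passing from r to a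
    smaller radius. *)
Lemma disk_seq_ode (rho : nat -> C) : disk_seq rho -> disk_seq (ode_seq rho).
Proof.
intros Hrho r' Hr'. pose (r := (1 + r') / 2). assert (Hr : 0 < r < 1) by (unfold r; lra).
assert (Hrr : r' < r) by (unfold r; lra).
destruct (Hrho r Hr) as [K HK].
assert (HK0 : 0 <= K).
{ specialize (HK O). simpl in HK. assert (X := Cmod_ge_0 (rho O)). lra. }
pose (Y := fun n => Cmod (ode_seq rho n) * r ^ n).
assert (HY : forall n, 0 <= Y n).
{ intros n. apply Rmult_le_pos; [apply Cmod_ge_0 | apply pow_le; lra]. }
pose (S_ := fun n => sum_f_R0 Y n).
assert (HS : forall n, 0 <= S_ n) by (intros; apply cond_pos_sum, HY).
assert (Hstep : forall n, INR (S n) * Y (S n) <= K * S_ n).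
{ intros n. unfold Y.
  replace (INR (S n) * (Cmod (ode_seq rho (S n)) * r ^ S n))
    with (Cmod (derived_seq (ode_seq rho) n) * r ^ n * r).
  2: { unfold derived_seq. rewrite Cmod_mult, Cmod_R, Rabs_pos_eq by apply pos_INR. simpl pow. ring. }
  rewrite ode_seq_rec.
  assert (Hc : forall N, (N <= n)%nat ->
    Cmod (partial_csum (fun k => rho k * ode_seq rho (n - k)%nat)%C N) * r ^ n
    <= K * sum_f_R0 (fun k => Y (n - k)%nat) N).
  { assert (Ht : forall k, (k <= n)%nat ->
      Cmod (rho k * ode_seq rho (n - k)%nat) * r ^ n <= K * Y (n - k)%nat).
    { intros k Hk. replace (r ^ n) with (r ^ k * r ^ (n - k)) by (rewrite <- pow_add; f_equal; lia).
      rewrite Cmod_mult.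
      replace (Cmod (rho k) * Cmod (ode_seq rho (n - k)) * (r ^ k * r ^ (n - k)))
        with (Cmod (rho k) * r ^ k * Y (n - k)%nat) by (unfold Y; ring).
      apply Rmult_le_compat_r; [apply HY | apply HK]. }
    intros N. induction N as [|N IH]; intros HN; simpl; [apply (Ht O); lia|].
    assert (Hp : 0 <= r ^ n) by (apply pow_le; lra).
    apply Rle_trans with ((Cmod (partial_csum (fun k => rho k * ode_seq rho (n - k)%nat)%C N)
      + Cmod (rho (S N) * ode_seq rho (n - S N)%nat)) * r ^ n).
    - apply Rmult_le_compat_r; [exact Hp | apply Cmod_triangle].
    - rewrite Rmult_plus_distr_r, Rmult_plus_distr_l.
      apply Rplus_le_compat; [apply IH; lia | apply Ht; lia]. }
  specialize (Hc n (Nat.le_refl n)).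
  replace (sum_f_R0 (fun k => Y (n - k)%nat) n) with (S_ n) in Hc.
  - fold (cconv rho (ode_seq rho) n) in Hc.
    assert (0 <= Cmod (cconv rho (ode_seq rho) n) * r ^ n)
      by (apply Rmult_le_pos; [apply Cmod_ge_0 | apply pow_le; lra]).
    nra.
  - unfold S_. symmetry. apply sum_f_R0_skip. }
(* The choice t = r/r' makes |y_n| r'^n equal to Y_n / t^n. *)
pose (t := r / r'). assert (Ht : 1 < t) by (apply Rlt_div_r; lra).
assert (Er : r = t * r') by (unfold t; field; lra).
destruct (INR_unbounded (K / (t - 1))) as [N HN].
assert (HNK : K <= (t - 1) * INR N).
{ apply Rgt_lt in HN. apply (Rmult_lt_compat_l (t - 1)) in HN; [|lra].
  replace ((t - 1) * (K / (t - 1))) with K in HN by (field; lra). lra. }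
assert (Hmono : forall n m, (n <= m)%nat -> S_ n <= S_ m).
{ intros n m H. induction H as [|m H IH]; [lra|]. unfold S_ in *. simpl.
  specialize (HY (S m)). lra. }
assert (Hgr : forall n, S_ n <= S_ N * t ^ n).
{ induction n as [|n IH].
  - simpl. rewrite Rmult_1_r. apply Hmono. lia.
  - destruct (Compare_dec.le_lt_dec (S n) N) as [L|G].
    + apply Rle_trans with (S_ N * 1); [rewrite Rmult_1_r; now apply Hmono|].
      apply Rmult_le_compat_l; [apply HS | apply pow_R1_Rle; lra].
    + assert (Hn : INR N <= INR (S n)) by (apply le_INR; lia).
      assert (HnS : 0 < INR (S n)) by (apply lt_0_INR; lia).
      assert (Hy : Y (S n) <= (t - 1) * S_ n).
      { apply (Rmult_le_reg_l (INR (S n))); [exact HnS|].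
        eapply Rle_trans; [apply Hstep|].
        replace (INR (S n) * ((t - 1) * S_ n)) with ((t - 1) * INR (S n) * S_ n) by ring.
        apply Rmult_le_compat_r; [apply HS|].
        eapply Rle_trans; [exact HNK|]. apply Rmult_le_compat_l; lra. }
      change (S_ n + Y (S n) <= S_ N * (t * t ^ n)).
      apply Rle_trans with (t * S_ n); [lra|].
      replace (S_ N * (t * t ^ n)) with (t * (S_ N * t ^ n)) by ring.
      apply Rmult_le_compat_l; [lra | exact IH]. }
exists (S_ N). intros n. assert (Hp : 0 < t ^ n) by (apply pow_lt; lra).
apply (Rmult_le_reg_r (t ^ n)); [exact Hp|].
replace (Cmod (ode_seq rho n) * r' ^ n * t ^ n) with (Y n)
  by (unfold Y; rewrite Er, Rpow_mult_distr; ring).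
eapply Rle_trans; [|apply Hgr]. unfold S_. destruct n as [|n]; simpl; [lra|].
assert (X := cond_pos_sum Y n HY). lra.
Qed.

Lemma real_const_of_quadratic (f : R -> R) :
  (forall t, 0 <= t <= 1 -> exists M d, 0 < d /\
     forall s, Rabs s < d -> Rabs (f (t + s) - f t) <= M * Rabs s * Rabs s) ->
  f 0 = f 1.
Proof.
intros H. apply (eq_is_derive (V := R_NormedModule) f 0 1); [|lra].
intros t Ht. destruct (H t Ht) as [M [d [Hd HM]]].
split; [apply is_linear_scal_l|].
intros x Hx. replace x with t
  by (apply (is_filter_lim_locally_unique (V := R_NormedModule)); exact Hx).
intros eps.
assert (HMp : 0 < Rabs M + 1) by (assert (X := Rabs_pos M); lra).
assert (He : 0 < Rmin d (eps / (Rabs M + 1))).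
{ apply Rmin_pos; [exact Hd|]. apply Rdiv_lt_0_compat; [apply cond_pos | exact HMp]. }
assert (G : forall y : R, Rabs (y - t) < Rmin d (eps / (Rabs M + 1)) ->
  Rabs ((f y - f t) - (y - t) * 0) <= eps * Rabs (y - t)); [|exists (mkposreal _ He); exact G].
intros y Hy1.
assert (H1 : Rabs (y - t) < d) by (eapply Rlt_le_trans; [exact Hy1 | apply Rmin_l]).
assert (H2 : Rabs (y - t) < eps / (Rabs M + 1)) by (eapply Rlt_le_trans; [exact Hy1 | apply Rmin_r]).
specialize (HM (y - t) H1). replace (t + (y - t)) with y in HM by ring.
replace (f y - f t - (y - t) * 0) with (f y - f t) by ring.
eapply Rle_trans; [exact HM|]. apply Rmult_le_compat_r; [apply Rabs_pos|].
apply (Rmult_lt_compat_r (Rabs M + 1)) in H2; [|exact HMp].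
replace (eps / (Rabs M + 1) * (Rabs M + 1)) with (pos eps) in H2 by (field; lra).
assert (X := Rle_abs M). assert (X2 := Rabs_pos (y - t)). nra.
Qed.

(** Restrict to the segment from 0 to z: without a linear term, the real and imaginary parts of p(t
    z) have quadratic increments in t. *)
Lemma zero_derivative_const (p : C -> C) :
  (forall z, unit_disk z -> exists D, taylor2 p z (p z) 0 D) ->
  forall z, unit_disk z -> p z = p 0.
Proof.
intros Hp z Hz.
assert (Hq : forall t, 0 <= t <= 1 -> exists M d, 0 < d /\ forall s, Rabs s < d ->
  Cmod (p ((t + s)%R * z)%C - p (t * z)%C) <= M * Rabs s * Rabs s).
{ intros t Ht. assert (Htz : unit_disk (t * z)%C).
  { unfold unit_disk in *. rewrite Cmod_mult, Cmod_R, Rabs_pos_eq by lra.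
    assert (X := Cmod_ge_0 z). nra. }
  destruct (Hp _ Htz) as [D [r [Hr H]]].
  destruct (lb_plus (fun _ => D) (fun h => h * r h)%C) as [K [d [Hd HK]]]; [lb | lb |].
  exists (K * Cmod z * Cmod z), d. split; [exact Hd|]. intros s Hs.
  assert (Es : Cmod (s * z) = Rabs s * Cmod z) by (now rewrite Cmod_mult, Cmod_R).
  assert (Hsz : Cmod (s * z) < d).
  { rewrite Es. unfold unit_disk in Hz. assert (X := Rabs_pos s). assert (X' := Cmod_ge_0 z). nra. }
  replace ((t + s)%R * z)%C with (t * z + s * z)%C by (rewrite RtoC_plus; ring).
  rewrite H.
  replace (p (t * z)%C + 0 * (s * z) + D * (s * z) ^ 2 + (s * z) ^ 3 * r (s * z)%C - p (t * z)%C)%C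
    with ((D + s * z * r (s * z)%C) * (s * z * (s * z)))%C by ring.
  rewrite !Cmod_mult, <- (Cmod_mult s z), Es.
  replace (K * Cmod z * Cmod z * Rabs s * Rabs s) with (K * (Rabs s * Cmod z * (Rabs s * Cmod z))) by ring.
  apply Rmult_le_compat_r; [|now apply HK].
  assert (X := Rabs_pos s). assert (X' := Cmod_ge_0 z).
  repeat apply Rmult_le_pos; assumption. }
assert (E1 : Re (p (0 * z)%C) = Re (p (1 * z)%C)).
{ apply (real_const_of_quadratic (fun t => Re (p (t * z)%C))). intros t Ht.
  destruct (Hq t Ht) as [M [d [Hd HM]]]. exists M, d. split; [exact Hd|]. intros s Hs.
  eapply Rle_trans; [|apply (HM s Hs)]. exact (re_le_Cmod (p ((t + s)%R * z)%C - p (t * z)%C)). }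
assert (E2 : Im (p (0 * z)%C) = Im (p (1 * z)%C)).
{ apply (real_const_of_quadratic (fun t => Im (p (t * z)%C))). intros t Ht.
  destruct (Hq t Ht) as [M [d [Hd HM]]]. exists M, d. split; [exact Hd|]. intros s Hs.
  eapply Rle_trans; [|apply (HM s Hs)]. exact (im_le_Cmod (p ((t + s)%R * z)%C - p (t * z)%C)). }
replace (0 * z)%C with (RtoC 0) in E1, E2 by ring.
replace (1 * z)%C with z in E1, E2 by ring.
destruct (p z), (p 0). unfold Re, Im in *. simpl in *. now subst.
Qed.

(** (u v)' = 0. In [ode_solution] one such v shows both that solutions have no zeros and that they
    coincide, being inverses of the same function. *)
Lemma ode_reciprocal (rho u v : C -> C) :
  (forall z, unit_disk z -> exists D, taylor2 u z (u z) (rho z * u z) D) ->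
  (forall z, unit_disk z -> exists D, taylor2 v z (v z) (- (rho z * v z)) D) ->
  u 0 = 1 -> v 0 = 1 -> forall z, unit_disk z -> (u z * v z)%C = 1.
Proof.
intros Hu Hv Hu0 Hv0 z Hz.
rewrite (zero_derivative_const (fun x => u x * v x)%C); [rewrite Hu0, Hv0; ring| |exact Hz].
intros x Hx. destruct (Hu x Hx) as [D T], (Hv x Hx) as [D' T'].
eexists. assert (X := taylor2_mult _ _ _ _ _ _ _ _ _ T T').
replace (RtoC 0) with (u x * - (rho x * v x) + rho x * u x * v x)%C by ring. exact X.
Qed.

Lemma ode_exists (b : nat -> C) (R_ : C -> C) :
  is_ps b R_ -> exists y, is_ps (ode_seq b) y /\ y 0 = 1 /\
    forall z, unit_disk z -> exists D, taylor2 y z (y z) (R_ z * y z) D.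
Proof.
intros HR. destruct (ps_exists _ (disk_seq_ode b (proj1 HR))) as [y Hy].
exists y. split; [exact Hy|]. split; [exact (ps_value_0 _ _ Hy)|].
intros z Hz. destruct (ps_derived _ _ Hy) as [y' [Hy' H]].
destruct (H z Hz) as [D T]. exists D.
replace (R_ z * y z)%C with (y' z); [exact T|].
apply (csum_unique _ _ _ (proj2 Hy' z Hz)).
eapply csum_ext; [|exact (csum_ps_mult _ _ _ _ z HR Hy Hz)].
intros n. simpl. now rewrite ode_seq_rec.
Qed.

Lemma ode_solution (b : nat -> C) (R_ : C -> C) :
  is_ps b R_ -> exists c y, is_ps c y /\ c 0%nat = 1 /\
    (forall z, unit_disk z -> y z <> 0) /\
    (forall z, unit_disk z -> exists D, taylor2 y z (y z) (R_ z * y z) D) /\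
    (forall v : C -> C, v 0 = 1 ->
       (forall z, unit_disk z -> exists D, taylor2 v z (v z) (R_ z * v z) D) ->
       forall z, unit_disk z -> v z = y z).
Proof.
intros HR. destruct (ode_exists b R_ HR) as [y [Hy [Hy0 Ty]]].
destruct (ode_exists _ _ (ps_scal (- (1)) b R_ HR)) as [x [Hx [Hx0 Tx]]].
assert (Tx' : forall z, unit_disk z -> exists D, taylor2 x z (x z) (- (R_ z * x z)) D).
{ intros z Hz. destruct (Tx z Hz) as [D T]. exists D.
  replace (- (R_ z * x z))%C with (- (1) * R_ z * x z)%C by ring. exact T. }
exists (ode_seq b), y. split; [exact Hy|]. split; [reflexivity|].
assert (E := ode_reciprocal R_ y x Ty Tx' Hy0 Hx0).
split; [|split; [exact Ty|]].
- intros z Hz E0. specialize (E z Hz). rewrite E0, Cmult_0_l in E.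
  apply C1_nz. now symmetry.
- intros v Hv0 Tv z Hz. assert (Ev := ode_reciprocal R_ v x Tv Tx' Hv0 Hx0 z Hz).
  specialize (E z Hz).
  transitivity (v z * (y z * x z))%C; [rewrite E; ring|].
  transitivity (y z * (v z * x z))%C; [ring | rewrite Ev; ring].
Qed.

(** * The function psi_AP *)

(** Each application integrates once, discarding the factor 1/(n + 1); iteration raises crude
    order-zero bounds to Taylor remainders. *)
Lemma mvt_pow_bound (g g' : R -> R) (K : R) (n : nat) :
  (forall x, is_derive g x (g' x)) -> g 0 = 0 ->
  (forall x, Rabs x <= 1 -> Rabs (g' x) <= K * Rabs x ^ n) ->
  forall x, Rabs x <= 1 -> Rabs (g x) <= K * Rabs x ^ S n.
Proof.
intros Hg H0 Hb x Hx.
assert (HK : 0 <= K).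
{ specialize (Hb 1). rewrite Rabs_R1, pow1 in Hb. assert (X := Rabs_pos (g' 1)). lra. }
destruct (MVT_gen g 0 x g') as [c [Hc E]].
- intros y _. apply Hg.
- intros y _. apply continuity_pt_filterlim, (ex_derive_continuous (V := R_NormedModule)).
  eexists. apply Hg.
- rewrite H0, !Rminus_0_r in E. rewrite E, Rabs_mult.
  assert (Hcx : Rabs c <= Rabs x).
  { unfold Rmin, Rmax in Hc. destruct (Rle_dec 0 x).
    - rewrite !Rabs_pos_eq; lra.
    - rewrite !Rabs_left1; lra. }
  replace (K * Rabs x ^ S n) with (K * Rabs x ^ n * Rabs x) by (simpl; ring).
  apply Rmult_le_compat_r; [apply Rabs_pos|].
  eapply Rle_trans; [apply Hb; lra|].
  apply Rmult_le_compat_l; [exact HK|]. apply pow_incr. split; [apply Rabs_pos | exact Hcx].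
Qed.

Lemma exp_taylor2 (x : R) : Rabs x <= 1 -> Rabs (exp x - (1 + x + x ^ 2 / 2)) <= 3 * Rabs x ^ 3.
Proof.
assert (H0 : forall x, Rabs x <= 1 -> Rabs (exp x) <= 3 * Rabs x ^ 0).
{ intros y Hy. rewrite Rabs_pos_eq by (left; apply exp_pos). rewrite pow_O, Rmult_1_r.
  apply Rle_trans with (exp 1); [|apply exp_le_3].
  assert (Hy1 : y <= 1) by (assert (X := Rle_abs y); lra).
  destruct (Rle_lt_or_eq_dec _ _ Hy1) as [L| ->]; [left; now apply exp_increasing | lra]. }
assert (H1 := mvt_pow_bound (fun x => exp x - 1) exp 3 0
  ltac:(intros y; auto_derive; [trivial | ring]) ltac:(cbv beta; rewrite exp_0; ring) H0).
assert (H2 := mvt_pow_bound (fun x => exp x - (1 + x)) (fun x => exp x - 1) 3 1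
  ltac:(intros y; auto_derive; [trivial | ring]) ltac:(cbv beta; rewrite exp_0; ring) H1).
apply (mvt_pow_bound (fun x => exp x - (1 + x + x ^ 2 / 2)) (fun x => exp x - (1 + x)) 3 2).
- intros y; auto_derive; [trivial | field].
- rewrite exp_0; field.
- exact H2.
Qed.

Lemma sin_cos_taylor (x : R) : Rabs x <= 1 ->
  Rabs (cos x - (1 - x ^ 2 / 2)) <= Rabs x ^ 3 /\ Rabs (sin x - x) <= Rabs x ^ 3.
Proof.
assert (C0 : forall x, Rabs x <= 1 -> Rabs (cos x) <= 1 * Rabs x ^ 0).
{ intros y _. rewrite pow_O. apply Rabs_le. assert (X := COS_bound y). lra. }
assert (S1 := mvt_pow_bound sin cos 1 0
  ltac:(intros y; auto_derive; [trivial | ring]) sin_0 C0).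
assert (C2 := mvt_pow_bound (fun x => cos x - 1) (fun x => - sin x) 1 1
  ltac:(intros y; auto_derive; [trivial | ring]) ltac:(cbv beta; rewrite cos_0; ring)
  ltac:(intros y Hy; cbv beta; rewrite Rabs_Ropp; now apply S1)).
assert (S3 := mvt_pow_bound (fun x => sin x - x) (fun x => cos x - 1) 1 2
  ltac:(intros y; auto_derive; [trivial | ring]) ltac:(cbv beta; rewrite sin_0; ring) C2).
assert (S2 : forall x, Rabs x <= 1 -> Rabs (- (sin x - x)) <= 1 * Rabs x ^ 2).
{ intros y Hy. rewrite Rabs_Ropp. eapply Rle_trans; [now apply S3|].
  assert (X := Rabs_pos y). assert (0 <= Rabs y ^ 2) by (now apply pow_le). simpl pow in *. nra. }
assert (C3 := mvt_pow_bound (fun x => cos x - (1 - x ^ 2 / 2)) (fun x => - (sin x - x)) 1 2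
  ltac:(intros y; auto_derive; [trivial | field])
  ltac:(cbv beta; rewrite cos_0; field) S2).
intros Hx. specialize (C3 x Hx). specialize (S3 x Hx). rewrite Rmult_1_l in C3, S3. now split.
Qed.

Lemma Cexp_plus (a b : C) : Cexp (a + b) = (Cexp a * Cexp b)%C.
Proof.
destruct a as [x y], b as [u v]. unfold Cexp, Cmult, Re, Im. simpl.
rewrite exp_plus, cos_plus, sin_plus. f_equal; ring.
Qed.

Lemma Cexp_0 : Cexp 0 = 1.
Proof. unfold Cexp, RtoC, Re, Im. simpl. rewrite exp_0, cos_0, sin_0. f_equal; ring. Qed.

Lemma Cexp_0_bound (h : C) :
  Cmod h < 1 -> Cmod (Cexp h - (1 + h + h ^ 2 / 2)) <= 11 * Cmod h ^ 3.
Proof.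
intros Hh. set (m := Cmod h) in *. assert (Hm : 0 <= m) by apply Cmod_ge_0.
assert (Hx : Rabs (Re h) <= m) by apply re_le_Cmod.
assert (Hy : Rabs (Im h) <= m) by apply im_le_Cmod.
destruct h as [x y]. simpl Re in *; simpl Im in *. clearbody m.
assert (He := exp_taylor2 x ltac:(lra)).
destruct (sin_cos_taylor y ltac:(lra)) as [Hc Hs].
assert (Hx3 : Rabs x ^ 3 <= m ^ 3) by (apply pow_incr; split; [apply Rabs_pos | exact Hx]).
assert (Hy3 : Rabs y ^ 3 <= m ^ 3) by (apply pow_incr; split; [apply Rabs_pos | exact Hy]).
assert (Hm3 : 0 <= m ^ 3) by now apply pow_le.
set (A0 := 1 + x + x ^ 2 / 2) in *.
pose (B := (cos y, sin y) : C). pose (B0 := (1 - y ^ 2 / 2, y) : C).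
assert (HB : Cmod B = 1).
{ unfold B, Cmod. simpl. assert (X := sin2_cos2 y). unfold Rsqr in X.
  replace (cos y * (cos y * 1) + sin y * (sin y * 1)) with 1 by lra. apply sqrt_1. }
assert (HB0 : Cmod (B - B0) <= 2 * m ^ 3).
{ eapply Rle_trans; [apply (Cmod_le_Rabs (cos y - (1 - y ^ 2 / 2)) (sin y - y))|]. lra. }
assert (HA0 : Rabs A0 <= 3).
{ assert (X := proj1 (Rabs_le_between x m) Hx). apply Rabs_le. unfold A0. nra. }
(* With A0, B0 the quadratic polynomials of e^x and e^(iy), the last pair holds the terms of A0 B0
   of degree at least 3. The pieces cost 3, 3 times 2, and 2, whence 11. *)
replace (Cexp (x, y) - (1 + (x, y) + (x, y) ^ 2 / 2))%C
  with ((RtoC (exp x - A0) * B + RtoC A0 * (B - B0))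
    + (- (x * y ^ 2 / 2) - x ^ 2 * y ^ 2 / 4, x ^ 2 * y / 2)%R)%C.
2: { unfold A0, B, B0, Cexp, Cdiv, Cinv, Cminus, Copp, Cplus, Cmult, Cpow, RtoC, Re, Im. simpl.
     f_equal; field. }
eapply Rle_trans; [apply Cmod_triangle|].
apply Rle_trans with ((3 * m ^ 3 + 3 * (2 * m ^ 3)) + 2 * m ^ 3); [|lra].
apply Rplus_le_compat.
- eapply Rle_trans; [apply Cmod_triangle|]. rewrite !Cmod_mult, HB, !Cmod_R.
  apply Rplus_le_compat; [lra|].
  apply Rmult_le_compat; [apply Rabs_pos | apply Cmod_ge_0 | exact HA0 | exact HB0].
- eapply Rle_trans; [apply Cmod_le_Rabs|].
  assert (Bx : forall i j : nat, Rabs (x ^ i * y ^ j) <= m ^ (i + j)).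
  { intros i j. rewrite Rabs_mult, <- !RPow_abs, pow_add.
    apply Rmult_le_compat; try (apply pow_le, Rabs_pos);
      apply pow_incr; (split; [apply Rabs_pos | assumption]). }
  assert (B12 := Bx 1%nat 2%nat). assert (B22 := Bx 2%nat 2%nat). assert (B21 := Bx 2%nat 1%nat).
  change (1 + 2)%nat with 3%nat in B12. change (2 + 1)%nat with 3%nat in B21.
  change (2 + 2)%nat with 4%nat in B22.
  assert (m ^ 4 <= m ^ 3) by (replace (m ^ 4) with (m * m ^ 3) by ring; nra).
  replace (- (x * y ^ 2 / 2) - x ^ 2 * y ^ 2 / 4)
    with (- / 2 * (x ^ 1 * y ^ 2) + - / 4 * (x ^ 2 * y ^ 2)) by field.
  replace (x ^ 2 * y / 2) with (/ 2 * (x ^ 2 * y ^ 1)) by field.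
  rewrite (Rabs_mult (/ 2)), (Rabs_pos_eq (/ 2)) by lra.
  assert (T := Rabs_triang (- / 2 * (x ^ 1 * y ^ 2)) (- / 4 * (x ^ 2 * y ^ 2))).
  rewrite !Rabs_mult, !Rabs_Ropp in T.
  rewrite (Rabs_pos_eq (/ 2)), (Rabs_pos_eq (/ 4)) in T by lra.
  rewrite <- !Rabs_mult in T. lra.
Qed.

Lemma taylor2_Cexp (z : C) : taylor2 Cexp z (Cexp z) (Cexp z) (Cexp z / 2).
Proof.
apply (taylor2_intro _ _ _ _ _ 1
  (fun h => Cexp z * ((Cexp h - (1 + h + h ^ 2 / 2)) / h ^ 3))%C); [lra| |].
- apply lb_mult; [lb|]. apply (lb_punctured _ 11 1); [lra|]. intros h Nh Hh.
  apply Cdiv_bound; [now apply Cpow_nz|]. rewrite Cmod_pow. now apply Cexp_0_bound.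
- intros h Hh. rewrite Cexp_plus. destruct (Ceq_dec h 0) as [->|Nh].
  + rewrite Cexp_0. ring.
  + field. exact Nh.
Qed.

(** A purely imaginary root would give 1 + z = -q^2, hence a real z <= -1. *)
Lemma Csqrt_1_plus_re_pos (z : C) : unit_disk z -> 0 < Re (Csqrt (1 + z)).
Proof.
intros Hz. assert (E := Csqrt_sqr (1 + z)). assert (H := Csqrt_re_nonneg (1 + z)).
destruct (Rle_lt_or_eq_dec _ _ H) as [L|E0]; [exact L|]. exfalso.
destruct (Csqrt (1 + z)) as [p q]. simpl in E0. subst p.
assert (E1 : z = RtoC (- 1 - q ^ 2)).
{ transitivity ((1 + z) - 1)%C; [ring|]. rewrite <- E.
  unfold Cpow, Cminus, Copp, Cplus, Cmult, RtoC. simpl. f_equal; ring. }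
unfold unit_disk in Hz. assert (X := pow2_ge_0 q). rewrite E1, Cmod_R, Rabs_left1 in Hz; lra.
Qed.

Lemma Csqrt_1_plus_neq_0 (z : C) : unit_disk z -> Csqrt (1 + z) <> 0.
Proof.
intros Hz E. assert (H := Csqrt_1_plus_re_pos z Hz). rewrite E in H. simpl in H. lra.
Qed.

(** Local inversion of squaring. The factor [sigma] is 1 over a sum of two roots with real parts
    nonnegative and positive, hence bounded, which replaces a continuity proof for the branch. The
    coefficients are left as [taylor2_local_inverse] produces them. *)
Lemma taylor2_Csqrt_1_plus (z : C) : unit_disk z ->
  taylor2 (fun x => Csqrt (1 + x)) z (Csqrt (1 + z)) (1 / (2 * Csqrt (1 + z)))
    ((0 - 1 * (1 / (2 * Csqrt (1 + z))) ^ 2) / (2 * Csqrt (1 + z))).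
Proof.
intros Hz. set (s := Csqrt (1 + z)).
assert (Hs : 0 < Re s) by now apply Csqrt_1_plus_re_pos.
assert (Hn := Csqrt_1_plus_neq_0 z Hz). fold s in Hn.
assert (H2 : RtoC 2 <> 0) by (intros E; apply RtoC_inj in E; lra).
pose (sigma := fun h => (/ (Csqrt (1 + (z + h)) + s))%C).
assert (Hre : forall h, Re s <= Cmod (Csqrt (1 + (z + h)) + s)).
{ intros h. eapply Rle_trans; [|apply re_le_Cmod].
  assert (X := Csqrt_re_nonneg (1 + (z + h))). change (Re (Csqrt (1 + (z + h)) + s)) with (Re (Csqrt (1 + (z + h))) + Re s).
  rewrite Rabs_pos_eq; lra. }
assert (Hne : forall h, (Csqrt (1 + (z + h)) + s)%C <> 0).
{ intros h. apply Cmod_gt_0. assert (X := Hre h). lra. }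
apply (taylor2_local_inverse (fun x => x * x)%C _ sigma z s (s * s) (2 * s) 1 (1 + z) 1 0).
- assert (X := taylor2_mult _ _ _ _ _ _ _ _ _ (taylor2_id s) (taylor2_id s)).
  replace (2 * s)%C with (s * 1 + 1 * s)%C by ring.
  replace (RtoC 1) with (s * 0 + 1 * 1 + 0 * s)%C at 3 by ring. exact X.
- now apply Cmult_neq_0.
- exists (/ Re s), 1. split; [lra|]. intros h _. unfold sigma. rewrite Cmod_inv by apply Hne.
  apply Rinv_le_contravar; [exact Hs | apply Hre].
- intros h. unfold sigma.
  replace h with (Csqrt (1 + (z + h)) ^ 2 - s ^ 2)%C at 2
    by (unfold s; rewrite !Csqrt_sqr; ring).
  field. apply Hne.
- apply (taylor2_ext (fun x => 1 + x)%C).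
  + intros x. rewrite <- (Csqrt_sqr (1 + x)) at 1. ring.
  + exists (fun _ => RtoC 0). split; [lb|]. intros h. ring.
Qed.

(** The linear coefficient is psi_AP times its logarithmic derivative, the form used for
    nonvanishing and for the differential equation. *)
Lemma taylor2_psi_AP (z : C) : unit_disk z ->
  let s := Csqrt (1 + z) in let e := Cexp z in
  taylor2 psi_AP z (psi_AP z) (psi_AP z * (1 + / (2 * (1 + z))))
    (e * (- / (8 * s ^ 3) + / (2 * s) + s / 2)).
Proof.
intros Hz s e. assert (Hn := Csqrt_1_plus_neq_0 z Hz). fold s in Hn.
assert (T := taylor2_Csqrt_1_plus z Hz).
assert (X := taylor2_mult _ _ _ _ _ _ _ _ _ (taylor2_Cexp z) T). fold s e in X.
assert (H2 : RtoC 2 <> 0) by (intros E; apply RtoC_inj in E; lra).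
assert (E1 : (psi_AP z * (1 + / (2 * (1 + z))))%C = (e * (1 / (2 * s)) + e * s)%C).
{ rewrite <- (Csqrt_sqr (1 + z)). unfold psi_AP. fold s e. field. repeat split; assumption. }
rewrite E1.
replace (e * (- / (8 * s ^ 3) + / (2 * s) + s / 2))%C
  with (e * ((0 - 1 * (1 / (2 * s)) ^ 2) / (2 * s)) + e * (1 / (2 * s)) + e / 2 * s)%C; [exact X|].
replace (RtoC 8) with (2 * 2 * 2)%C by (rewrite <- !RtoC_mult; f_equal; ring).
field. repeat split; assumption.
Qed.

(** The logarithmic derivative (3 + 2z)/(2(1 + z)) vanishes only at -3/2, outside the disk. *)
Lemma psi_AP_derivative_neq_0 (z : C) :
  unit_disk z -> (psi_AP z * (1 + / (2 * (1 + z))))%C <> 0.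
Proof.
intros Hz. apply Cmult_neq_0; [now apply psi_AP_neq_0|]. intros E.
assert (H2 : RtoC 2 <> 0) by (intros E'; apply RtoC_inj in E'; lra).
unfold unit_disk in Hz.
assert (H1 : (1 + z)%C <> 0).
{ apply Cmod_gt_0. assert (X := Cmod_plus_ge 1 z). rewrite Cmod_1 in X. lra. }
assert (E2 : (3 + 2 * z)%C = 0).
{ transitivity (2 * (1 + z) * (1 + / (2 * (1 + z))))%C; [|rewrite E; ring].
  replace (RtoC 3) with (2 + 1)%C by (rewrite <- RtoC_plus; f_equal; ring). field. repeat split; assumption. }
assert (X := Cmod_plus_ge 3 (2 * z)). rewrite E2, Cmod_0, Cmod_mult, !Cmod_R in X.
rewrite !Rabs_pos_eq in X by lra. lra.
Qed.

Lemma taylor2_psi_AP_0 : taylor2 psi_AP 0 1 (RtoC (3 / 2)) (RtoC (7 / 8)).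
Proof.
assert (X := taylor2_psi_AP 0 unit_disk_0). simpl in X.
assert (Es : Csqrt (1 + 0) = 1).
{ assert (E := Csqrt_sqr (1 + 0)). assert (H := Csqrt_1_plus_re_pos 0 unit_disk_0).
  assert (E2 : ((Csqrt (1 + 0) - 1) * (Csqrt (1 + 0) + 1))%C = 0).
  { transitivity (Csqrt (1 + 0) ^ 2 - 1)%C; [ring | rewrite E; ring]. }
  destruct (Ceq_dec (Csqrt (1 + 0) - 1) 0) as [E3|N].
  - replace (Csqrt (1 + 0)) with (Csqrt (1 + 0) - 1 + 1)%C by ring. rewrite E3. ring.
  - exfalso. refine (Cmult_neq_0 _ _ N _ E2). intros E4.
    assert (E5 := f_equal Re E4). change (Re (Csqrt (1 + 0)) + 1 = 0) in E5. lra. }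
rewrite Es, Cexp_0 in X. unfold psi_AP in X at 2 3. rewrite Es, Cexp_0 in X.
replace (RtoC 1) with (1 * 1)%C at 1 by ring.
replace (RtoC (3 / 2)) with (1 * 1 * (1 + / (2 * (1 + 0))))%C.
replace (RtoC (7 / 8)) with (1 * (- / (8 * (1 * (1 * (1 * 1)))) + / (2 * 1) + 1 / 2))%C.
- exact X.
- unfold Cdiv, Cinv, Copp, Cplus, Cmult, RtoC. simpl. f_equal; field.
- unfold Cdiv, Cinv, Copp, Cplus, Cmult, RtoC. simpl. f_equal; field.
Qed.

(** * The lower bound *)

Lemma csum_terms_bounded (u : nat -> C) (l : C) :
  csum u l -> exists M, forall n, Cmod (u n) <= M.
Proof.
intros H.
destruct (filterlim_bounded (K := C_AbsRing) (V := C_NormedModule) _ (ex_intro _ l H)) as [M HM].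
assert (HP : forall n, Cmod (partial_csum u n) <= M).
{ intros n. rewrite partial_csum_sum_n. exact (HM n). }
exists (M + M). intros n. assert (X := HP n). destruct n as [|n].
- simpl in X. assert (Y := Cmod_ge_0 (u O)). lra.
- assert (Y := HP n). simpl in X.
  replace (u (S n)) with ((partial_csum u n + u (S n)) - partial_csum u n)%C by ring.
  eapply Rle_trans; [apply Cmod_triangle|]. rewrite Cmod_opp. lra.
Qed.

(** Passing to F = f/z, with F(0) = 1, removes the zero of f, so that z f'/f becomes 1 + z F'/F,
    regular at 0. *)
Lemma has_coefficients_ps (f : C -> C) (a : nat -> C) :
  has_coefficients f a -> exists b F, is_ps b F /\
    b 0%nat = 1 /\ b 1%nat = a 2%nat /\ b 2%nat = a 3%nat /\
    forall z, unit_disk z -> f z = (z * F z)%C.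
Proof.
intros Ha.
pose (b := fun n => match n with O => RtoC 1 | S m => a (m + 2)%nat end).
assert (Hb : disk_seq b).
{ intros r Hr. assert (Er : Cmod (RtoC r) = r) by (rewrite Cmod_R, Rabs_pos_eq; lra).
  destruct (csum_terms_bounded _ _ (Ha (RtoC r) ltac:(unfold unit_disk; lra))) as [M HM].
  assert (HM0 : 0 <= M) by (eapply Rle_trans; [apply Cmod_ge_0 | apply (HM O)]).
  assert (HMr : 0 <= M / r) by (apply Rdiv_le_0_compat; lra).
  exists (1 + M / r). intros [|n].
  - simpl. rewrite Cmod_1. lra.
  - specialize (HM n). rewrite Cmod_mult, Cmod_pow, Er in HM.
    assert (Cmod (b (S n)) * r ^ S n <= M / r); [|lra].
    apply (proj1 (Rle_div_r _ _ r (proj1 Hr))). simpl b.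
    replace (Cmod (a (n + 2)%nat) * r ^ S n * r) with (Cmod (a (n + 2)%nat) * r ^ (n + 2))
      by (rewrite pow_add; simpl; ring). exact HM. }
destruct (ps_exists b Hb) as [F HF]. exists b, F. split; [exact HF|].
do 3 (split; [reflexivity|]). intros z Hz.
assert (X := csum_shift _ _ (csum_scal z _ _ (proj2 HF z Hz))).
assert (E : (z * F z - z * (b 0%nat * z ^ 0))%C = (f z - z)%C).
{ apply (csum_unique _ _ _ X). eapply csum_ext; [|exact (Ha z Hz)].
  intros n. simpl b. rewrite Cpow_S, Cpow_add_r. simpl. ring. }
simpl in E. transitivity ((f z - z) + z)%C; [ring|]. rewrite <- E. ring.
Qed.

Lemma Cinv_0 : (/ 0)%C = 0.
Proof. unfold Cinv, RtoC, Rdiv. simpl. f_equal; ring. Qed.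

Lemma unit_disk_near (z h : C) : Cmod h < 1 - Cmod z -> unit_disk (z + h).
Proof. intros Hh. unfold unit_disk. eapply Rle_lt_trans; [apply Cmod_triangle|]. lra. Qed.

Lemma taylor2_ext_disk (f g : C -> C) (z A B D : C) :
  unit_disk z -> (forall x, unit_disk x -> f x = g x) ->
  taylor2 f z A B D -> taylor2 g z A B D.
Proof.
intros Hz E. apply (taylor2_ext_loc _ _ _ _ _ _ (1 - Cmod z)).
- unfold unit_disk in Hz; lra.
- intros h Hh. now apply E, unit_disk_near.
Qed.

Lemma starlike_quotient_taylor2 (f : C -> C) (a : nat -> C) :
  has_coefficients f a ->
  (forall z, unit_disk z -> starlike_quotient f z <> 0) ->
  taylor2_on_disk (starlike_quotient f) /\
  taylor2 (starlike_quotient f) 0 1 (a 2%nat) (2 * a 3%nat - a 2%nat ^ 2).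
Proof.
intros Ha Hq. destruct (has_coefficients_ps f a Ha) as [b [F [HF [b0 [b1 [b2 Ef]]]]]].
destruct (ps_derived b F HF) as [F' [HF' TF]].
assert (Df : forall z, unit_disk z -> C_derive f z = (F z + z * F' z)%C).
{ intros z Hz. apply is_C_derive_unique. destruct (TF z Hz) as [D T].
  assert (X := taylor2_mult _ _ _ _ _ _ _ _ _ (taylor2_id z) T).
  replace (F z + z * F' z)%C with (z * F' z + 1 * F z)%C by ring.
  refine (is_derive_taylor2 f z _ _ _ (taylor2_ext_disk _ f z _ _ _ Hz _ X)).
  intros x Hx. now rewrite Ef. }
assert (NF : forall z, unit_disk z -> F z <> 0).
{ intros z Hz E. destruct (Ceq_dec z 0) as [E0|N].
  - apply C1_nz. rewrite <- E, E0, (ps_value_0 _ _ HF). now symmetry.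
  (* A zero of f off the origin would give the quotient the default value 0 of division, which is
     excluded. *)
  - apply (Hq z Hz). unfold starlike_quotient.
    destruct (Ceq_dec z 0) as [E0|_]; [contradiction|].
    rewrite Ef, E by exact Hz. unfold Cdiv. rewrite Cmult_0_r, Cinv_0. ring. }
assert (Eq : forall z, unit_disk z -> (1 + z * (F' z * / F z))%C = starlike_quotient f z).
{ intros z Hz. unfold starlike_quotient. destruct (Ceq_dec z 0) as [E0|N].
  - rewrite E0. ring.
  - rewrite Df, Ef by exact Hz. field. split; [now apply NF | exact N]. }
(* The quadratic coefficient is made explicit only at z = 0, where the factor x shifts F'/F by one
   order and first-order data suffice. *)
assert (T0 : forall z A B D A' B' D' : C, A' <> 0 -> taylor2 F' z A B D -> taylor2 F z A' B' D' ->
  exists D0, taylor2 (fun x => 1 + x * (F' x * / F x))%C z (1 + z * (A * / A'))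
    (0 + (z * (A * (- B' / A' ^ 2) + B * / A') + 1 * (A * / A'))) D0 /\
   (z = 0 -> D0 = (A * (- B' / A' ^ 2) + B * / A')%C)).
{ intros z A B D A' B' D' N T T'.
  assert (X := taylor2_plus _ _ _ _ _ _ _ _ _ (taylor2_const 1 z)
    (taylor2_mult _ _ _ _ _ _ _ _ _ (taylor2_id z)
      (taylor2_mult _ _ _ _ _ _ _ _ _ T (taylor2_Cinv _ _ _ _ _ T' N)))).
  eexists. split; [exact X|]. intros ->. ring. }
split.
- intros z Hz. destruct (TF z Hz) as [D' T'].
  destruct (ps_taylor2 _ _ z HF' Hz) as [B [D T]].
  destruct (T0 z _ _ _ _ _ _ (NF z Hz) T T') as [D0 [X _]].
  do 3 eexists. exact (taylor2_ext_disk _ _ _ _ _ _ Hz Eq X).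
- assert (T := ps_taylor2_0 _ _ HF'). assert (T' := ps_taylor2_0 _ _ HF).
  rewrite b0, b1, b2 in T'.
  destruct (T0 (RtoC 0) _ _ _ _ _ _ C1_nz T T') as [D0 [X ED]]. specialize (ED eq_refl).
  apply (taylor2_ext_disk _ _ _ _ _ _ unit_disk_0 Eq).
  unfold derived_seq in X, ED. simpl INR in X, ED. rewrite b1, b2 in X, ED.
  replace (2 * a 3%nat - a 2%nat ^ 2)%C with D0.
  + replace (a 2%nat) with
      (0 + (0 * (1 * a 2%nat * (- a 2%nat / 1 ^ 2) + (1 + 1)%R * a 3%nat * / 1)
        + 1 * (1 * a 2%nat * / 1)))%C by field.
    replace (RtoC 1) with (1 + 0 * (1 * a 2%nat * / 1))%C at 1 by ring. exact X.
  + rewrite ED, RtoC_plus. field.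
Qed.

Lemma starlike_coefficients (f w : C -> C) (a : nat -> C) (c1 c2 : C) :
  has_coefficients f a -> (forall z, unit_disk z -> unit_disk (w z)) ->
  (forall z, unit_disk z -> starlike_quotient f z = psi_AP (w z)) ->
  taylor2 w 0 0 c1 c2 ->
  a 2%nat = (RtoC (3 / 2) * c1)%C /\
  a 3%nat = (RtoC (3 / 4) * c2 + RtoC (25 / 16) * c1 ^ 2)%C.
Proof.
intros Ha Hw E Tw.
destruct (starlike_quotient_taylor2 f a Ha) as [_ T].
{ intros z Hz. rewrite E by exact Hz. now apply psi_AP_neq_0, Hw. }
assert (T' := taylor2_ext_disk _ _ _ _ _ _ unit_disk_0 E T).
destruct (taylor2_unique _ _ _ _ _ _ _ _ T'
  (taylor2_comp _ _ _ _ _ _ _ _ _ Tw taylor2_psi_AP_0)) as [E1 E2].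
split; [exact E1|].
(* Since 2 a_3 - a_2^2 = (3/2) c2 + (7/8) c1^2 and a_2 = (3/2) c1, the constant 25/16 is (7/8 +
   9/4)/2. *)
transitivity ((2 * a 3%nat - a 2%nat ^ 2 + a 2%nat ^ 2) / 2)%C; [field|].
rewrite E2, E1.
replace (RtoC (25 / 16)) with ((RtoC (7 / 8) + RtoC (3 / 2) * RtoC (3 / 2)) / 2)%C.
replace (RtoC (3 / 4)) with (RtoC (3 / 2) / 2)%C.
- field.
- rewrite <- RtoC_div by lra. f_equal. field.
- rewrite <- RtoC_mult, <- RtoC_plus, <- RtoC_div by lra. f_equal. field.
Qed.

Lemma schwarz_taylor2 (f w : C -> C) (a : nat -> C) :
  has_coefficients f a -> schwarz_function w ->
  (forall z, unit_disk z -> starlike_quotient f z = psi_AP (w z)) ->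
  taylor2_on_disk w.
Proof.
intros Ha [Hw [_ Hwb]] E z Hz.
destruct (starlike_quotient_taylor2 f a Ha) as [T _].
{ intros x Hx. rewrite E by exact Hx. now apply psi_AP_neq_0, Hwb. }
destruct (T z Hz) as [A [B [D Tq]]].
destruct (ex_derive_lip w z (Hw z Hz)) as [s [Hs Es]].
do 3 eexists.
exact (taylor2_local_inverse psi_AP w s z (w z) _ _ _ _ _ _
  (taylor2_psi_AP (w z) (Hwb z Hz)) (psi_AP_derivative_neq_0 (w z) (Hwb z Hz)) Hs Es
  (taylor2_ext_disk _ _ _ _ _ _ Hz E Tq)).
Qed.

(** 25/36 is (25/16)/(9/4), the lambda for which the c1^2 term cancels. *)
Lemma F_functional_eq (lambda : C) (mu : R) (a : nat -> C) (c1 c2 : C) :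
  a 2%nat = (RtoC (3 / 2) * c1)%C ->
  a 3%nat = (RtoC (3 / 4) * c2 + RtoC (25 / 16) * c1 ^ 2)%C ->
  F_functional lambda mu a =
  Cmod (RtoC (3 / 4) * c2 - RtoC (9 / 4) * (lambda - RtoC (25 / 36)) * c1 ^ 2)
  - 3 / 2 * mu * Cmod c1.
Proof.
intros E2 E3. unfold F_functional. rewrite E2, E3.
rewrite (Cmod_mult (RtoC (3 / 2))), Cmod_R, Rabs_pos_eq by lra.
replace (RtoC (3 / 4) * c2 + RtoC (25 / 16) * c1 ^ 2 - lambda * (RtoC (3 / 2) * c1) ^ 2)%C
  with (RtoC (3 / 4) * c2 - RtoC (9 / 4) * (lambda - RtoC (25 / 36)) * c1 ^ 2)%C; [ring|].
replace (RtoC (25 / 16)) with (RtoC (9 / 4) * RtoC (25 / 36))%C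
  by (rewrite <- RtoC_mult; f_equal; field).
replace (RtoC (9 / 4)) with (RtoC (3 / 2) ^ 2)%C by (rewrite <- RtoC_pow; f_equal; field).
ring.
Qed.

(** This root is the positive zero of (9/4) d x^2 - (3/4)(1 - x^2). *)
Lemma sqrt_B_AP (d : R) : 0 <= d ->
  0 < sqrt (4 / (12 * d + 4)) /\ (3 * d + 1) * sqrt (4 / (12 * d + 4)) ^ 2 = 1.
Proof.
intros Hd. assert (H : 0 < 4 / (12 * d + 4)) by (apply Rdiv_lt_0_compat; lra).
split; [now apply sqrt_lt_R0|]. rewrite pow2_sqrt by lra. field. lra.
Qed.

(** G is at least the larger of 0 and (3/4)((3d + 1) x^2 - 1). After subtracting (3/2) mu x this
    falls linearly up to the zero s and then follows a parabola with vertex mu/(3d + 1). The three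
    cases are vertex at least 1, vertex at most s, and vertex between them, with minimum at 1, s and
    the vertex. *)
Lemma B_AP_le (lambda : C) (mu x G : R) :
  0 < mu -> 0 <= x <= 1 -> 0 <= G ->
  9 / 4 * Cmod (lambda - RtoC (25 / 36)) * x ^ 2 - 3 / 4 * (1 - x ^ 2) <= G ->
  B_AP lambda mu <= G - 3 / 2 * mu * x.
Proof.
intros Hmu Hx HG HGx. unfold B_AP. assert (Hd := Cmod_ge_0 (lambda - RtoC (25 / 36))).
set (d := Cmod (lambda - RtoC (25 / 36))) in *. cbv zeta.
destruct (Rle_dec d ((mu - 1) / 3)) as [H1|H1]; [|destruct (Rle_dec (mu ^ 2) (3 * d + 1)) as [H2|H2]].
(* The product is the parabola's value at x minus its value at 1. *)
- assert (0 <= (1 - x) * (3 / 2 * mu - (9 / 4 * d + 3 / 4) * (1 + x))); [|nra].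
  apply Rmult_le_pos; [lra|]. nra.
- destruct (sqrt_B_AP d Hd) as [Hs0 Hs]. set (s := sqrt (4 / (12 * d + 4))) in *. clearbody s.
  (* Up to s only G >= 0 is used; beyond s, the parabola increases because mu <= (3d + 1) s. *)
  destruct (Rle_dec x s) as [L|N]; [nra|].
  assert (Hms : mu * s <= 1).
  { apply Rsqr_incr_0; [|nra|lra]. unfold Rsqr.
    assert (mu ^ 2 * s ^ 2 <= (3 * d + 1) * s ^ 2) by (apply Rmult_le_compat_r; [apply pow2_ge_0 | lra]).
    lra. }
  assert (Hm : mu <= (3 * d + 1) * s).
  { apply (Rmult_le_reg_r s); [exact Hs0|]. lra. }
  assert (0 <= (x - s) * ((3 * d + 1) * (x + s) - 2 * mu)); [|nra].
  apply Rmult_le_pos; [lra|].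
  assert ((3 * d + 1) * s <= (3 * d + 1) * x) by (apply Rmult_le_compat_l; lra). lra.
- assert (E : 9 / 4 * d * x ^ 2 - 3 / 4 * (1 - x ^ 2) - 3 / 2 * mu * x
    - (- (3 / 4) - 3 * mu ^ 2 / (12 * d + 4))
    = 3 / (4 * (3 * d + 1)) * ((3 * d + 1) * x - mu) ^ 2) by (field; lra).
  assert (0 <= 3 / (4 * (3 * d + 1)) * ((3 * d + 1) * x - mu) ^ 2).
  { apply Rmult_le_pos; [apply Rdiv_le_0_compat; lra | apply pow2_ge_0]. }
  lra.
Qed.

(** The minimisers of [B_AP_le] as witnesses. [Rabs] appears because for the extremal functions the
    two terms of a_3 - lambda a_2^2 are aligned and their moduli subtract. *)
Lemma B_AP_attained (lambda : C) (mu : R) : 0 < mu -> exists x, 0 <= x <= 1 /\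
  Rabs (3 / 4 * (1 - x ^ 2) - 9 / 4 * Cmod (lambda - RtoC (25 / 36)) * x ^ 2) - 3 / 2 * mu * x
  = B_AP lambda mu.
Proof.
intros Hmu. unfold B_AP. assert (Hd := Cmod_ge_0 (lambda - RtoC (25 / 36))).
set (d := Cmod (lambda - RtoC (25 / 36))) in *. cbv zeta.
destruct (Rle_dec d ((mu - 1) / 3)) as [H1|H1]; [|destruct (Rle_dec (mu ^ 2) (3 * d + 1)) as [H2|H2]].
- exists 1. split; [lra|]. rewrite Rabs_left1; lra.
- destruct (sqrt_B_AP d Hd) as [Hs0 Hs]. set (s := sqrt (4 / (12 * d + 4))) in *. clearbody s.
  exists s. split; [nra|].
  replace (3 / 4 * (1 - s ^ 2) - 9 / 4 * d * s ^ 2) with (3 / 4 * (1 - (3 * d + 1) * s ^ 2)) by (clearbody d; field).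
  rewrite Hs, Rminus_diag, Rmult_0_r, Rabs_R0. field.
- assert (Hm : mu < 3 * d + 1) by lra. exists (mu / (3 * d + 1)). split.
  + split; [apply Rdiv_le_0_compat; lra | apply Rle_div_l; lra].
  + assert (E : 3 / 4 * (1 - (mu / (3 * d + 1)) ^ 2) - 9 / 4 * d * (mu / (3 * d + 1)) ^ 2
      = - (3 / 4 * ((mu ^ 2 - (3 * d + 1)) / (3 * d + 1)))) by (field; lra).
    rewrite E, Rabs_Ropp, Rabs_pos_eq; [field; lra|].
    apply Rmult_le_pos; [lra | apply Rdiv_le_0_compat; lra].
Qed.

Lemma F_functional_lower_bound (lambda : C) (mu : R) (f : C -> C) (a : nat -> C) :
  0 < mu -> class_S_AP f -> has_coefficients f a ->
  B_AP lambda mu <= F_functional lambda mu a.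
Proof.
intros Hmu [_ [w [Hw E]]] Ha.
assert (Tw := schwarz_taylor2 f w a Ha Hw E). destruct Hw as [_ [Hw0 Hwb]].
destruct (Tw 0 unit_disk_0) as [A [c1 [c2 T]]].
assert (EA := taylor2_value _ _ _ _ _ T). rewrite Hw0 in EA. subst A.
assert (Hs := schwarz_lemma w Tw Hw0 (fun z Hz => Rlt_le _ _ (Hwb z Hz))).
assert (H1 := schwarz_coeff1 w c1 c2 Hs T). assert (H2 := pick_coeff2 w c1 c2 Tw Hs T).
destruct (starlike_coefficients f w a c1 c2 Ha Hwb E T) as [E2 E3].
rewrite (F_functional_eq lambda mu a c1 c2 E2 E3).
apply B_AP_le; [exact Hmu | split; [apply Cmod_ge_0 | exact H1] | apply Cmod_ge_0|].
rewrite (Cmod_minus_sym (RtoC (3 / 4) * c2)).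
eapply Rle_trans; [|apply Cmod_minus_ge].
rewrite !Cmod_mult, Cmod_pow, !Cmod_R, !Rabs_pos_eq by lra. lra.
Qed.

(** * The extremal functions *)

Definition shift_seq (b : nat -> C) (n : nat) : C :=
  match n with O => RtoC 0 | S m => b m end.

Lemma ps_shift (b : nat -> C) (P : C -> C) :
  is_ps b P -> is_ps (shift_seq b) (fun z => z * P z)%C.
Proof.
intros [Hb HP]. split.
- intros r Hr. destruct (Hb r Hr) as [K HK]. exists K.
  assert (HK0 : 0 <= K).
  { specialize (HK O). simpl in HK. assert (X := Cmod_ge_0 (b O)). lra. }
  intros [|n]; simpl; [rewrite Cmod_0; lra|].
  specialize (HK n).
  assert (0 <= Cmod (b n) * r ^ n) by (apply Rmult_le_pos; [apply Cmod_ge_0 | apply pow_le; lra]).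
  nra.
- intros z Hz. replace (z * P z)%C with (shift_seq b 0 * z ^ 0 + z * P z)%C by (simpl; ring).
  apply (csum_unshift (fun n => shift_seq b n * z ^ n)%C).
  eapply csum_ext; [|exact (csum_scal z _ _ (HP z Hz))]. intros n. simpl. ring.
Qed.

Lemma one_minus_neq_0 (c z : C) : Cmod c <= 1 -> unit_disk z -> (1 - c * z)%C <> 0.
Proof.
intros Hc Hz. unfold unit_disk in Hz. apply Cmod_gt_0.
assert (X := Cmod_minus_ge 1 (c * z)). rewrite Cmod_1, Cmod_mult in X.
assert (Y := Cmod_ge_0 c). assert (Y' := Cmod_ge_0 z). nra.
Qed.

(** The closed form follows from the shift identity G - 1 = c z G. *)
Lemma ps_geometric (c : C) : Cmod c <= 1 -> is_ps (fun n => c ^ n)%C (fun z => / (1 - c * z))%C.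
Proof.
intros Hc.
assert (Hd : disk_seq (fun n => c ^ n)%C).
{ apply (disk_seq_intro _ 1). intros n. rewrite Cmod_pow, <- (pow1 n).
  apply pow_incr. split; [apply Cmod_ge_0 | exact Hc]. }
destruct (ps_exists _ Hd) as [G HG]. apply (ps_ext _ G); [|exact HG]. intros z Hz.
assert (X := csum_shift _ _ (proj2 HG z Hz)).
assert (Y := csum_scal (c * z) _ _ (proj2 HG z Hz)).
assert (E : (G z - c ^ 0 * z ^ 0)%C = (c * z * G z)%C).
{ apply (csum_unique _ _ _ X). eapply csum_ext; [|exact Y]. intros n. simpl. ring. }
assert (N := one_minus_neq_0 c z Hc Hz).
assert (E2 : ((1 - c * z) * G z)%C = 1).
{ transitivity (G z - c ^ 0 * z ^ 0 - c * z * G z + 1)%C; [simpl; ring | rewrite E; ring]. }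
transitivity ((1 - c * z) * G z / (1 - c * z))%C; [field; exact N|].
rewrite E2. field. exact N.
Qed.

(* The Schwarz function z (x + u z) / (1 + x u z) has initial coefficients x and u (1 - x^2). *)
Definition blaschke (x : R) (u z : C) : C := (z * (x + u * z) / (1 + x * u * z))%C.

Lemma blaschke_denominator_neq_0 (x : R) (u z : C) :
  0 <= x <= 1 -> Cmod u = 1 -> unit_disk z -> (1 + x * u * z)%C <> 0.
Proof.
intros Hx Hu Hz. replace (1 + x * u * z)%C with (1 - (- (x * u)) * z)%C by ring.
apply one_minus_neq_0; [|exact Hz].
rewrite Cmod_opp, Cmod_mult, Hu, Cmod_R, Rabs_pos_eq; lra.
Qed.

Lemma blaschke_le (x : R) (u z : C) :
  0 <= x <= 1 -> Cmod u = 1 -> unit_disk z -> Cmod (blaschke x u z) <= Cmod z.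
Proof.
intros Hx Hu Hz. assert (Hz' := Hz). unfold unit_disk in Hz'.
apply Cdiv_bound; [now apply blaschke_denominator_neq_0|].
rewrite Cmod_mult. apply Rmult_le_compat_l; [apply Cmod_ge_0|].
(* (x + u z)/(1 + x u z) is, up to sign, the Moebius quotient with a = -u z and b = x. *)
assert (X := mobius_bound (- (u * z)) x).
replace (- (u * z) - x)%C with (- (x + u * z))%C in X by ring.
replace (1 - Cconj x * - (u * z))%C with (1 + x * u * z)%C in X.
- rewrite !Cmod_opp, Cmod_mult, Hu, Cmod_R, Rabs_pos_eq in X by lra. apply X; lra.
- replace (Cconj x) with (RtoC x); [ring|]. unfold Cconj, RtoC. simpl. f_equal. ring.
Qed.

Lemma ps_blaschke (x : R) (u : C) : 0 <= x <= 1 -> Cmod u = 1 -> exists b,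
  is_ps b (blaschke x u) /\ b 0%nat = 0 /\ b 1%nat = x /\ b 2%nat = (u * (1 - x ^ 2))%C.
Proof.
intros Hx Hu.
assert (Hc : Cmod (- (x * u)) <= 1)
  by (rewrite Cmod_opp, Cmod_mult, Hu, Cmod_R, Rabs_pos_eq; lra).
assert (G := ps_shift _ _ (ps_geometric _ Hc)).
assert (P := ps_plus _ _ _ _ (ps_scal x _ _ G) (ps_scal u _ _ (ps_shift _ _ G))).
eexists. split; [refine (ps_ext _ _ _ _ P)|].
- intros z Hz. unfold blaschke. cbv beta.
  replace (1 - - (x * u) * z)%C with (1 + x * u * z)%C by ring.
  field. now apply blaschke_denominator_neq_0.
- simpl. repeat split; ring.
Qed.

(* The numerator of 1 + blaschke x u z is a quadratic without zeros in the disk. *)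
Lemma one_plus_blaschke_factor (x : R) (u : C) : 0 <= x <= 1 -> Cmod u = 1 ->
  exists al be : C, Cmod al <= 1 /\ Cmod be <= 1 /\
    (forall z, 1 + x * (1 + u) * z + u * z ^ 2 = (1 - al * z) * (1 - be * z))%C.
Proof.
intros Hx Hu. set (p := (x * (1 + u))%C).
set (dl := Csqrt (p ^ 2 - 4 * u)).
assert (Hdl : (dl ^ 2)%C = (p ^ 2 - 4 * u)%C) by apply Csqrt_sqr.
assert (Hf : forall z, (1 + p * z + u * z ^ 2
  = (1 - (dl - p) / 2 * z) * (1 - (- dl - p) / 2 * z))%C).
{ intros z. replace u with ((p ^ 2 - dl ^ 2) / 4)%C.
  - replace (RtoC 4) with (2 * 2)%C by (rewrite <- RtoC_mult; f_equal; ring). field.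
  - rewrite Hdl. field. }
assert (Hroot : forall al be : C,
  (forall z, (1 + p * z + u * z ^ 2 = (1 - al * z) * (1 - be * z))%C) -> Cmod al <= 1).
(* If |al| > 1, then 1/al lies in the disk and w takes the value -1 there, against |w(z)| <= |z|. *)
{ intros al be H. apply Rnot_lt_le. intros L.
  assert (Na : al <> 0) by (apply Cmod_gt_0; lra).
  assert (Hz : unit_disk (/ al)%C).
  { unfold unit_disk. rewrite Cmod_inv by exact Na. rewrite <- Rinv_1.
    apply Rinv_lt_contravar; lra. }
  assert (N := blaschke_denominator_neq_0 x u _ Hx Hu Hz).
  assert (B := blaschke_le x u _ Hx Hu Hz).
  assert (E : blaschke x u (/ al)%C = (- (1))%C).
  { unfold blaschke. set (z := (/ al)%C) in *.
    transitivity (((1 + p * z + u * z ^ 2) - (1 + x * u * z)) / (1 + x * u * z))%C.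
    - unfold p. field. exact N.
    - rewrite H. replace (1 - al * z)%C with (RtoC 0) by (unfold z; field; exact Na).
      field. exact N. }
  rewrite E, Cmod_m1 in B. unfold unit_disk in Hz. lra. }
exists ((dl - p) / 2)%C, ((- dl - p) / 2)%C. split; [|split].
- exact (Hroot _ _ Hf).
- apply (Hroot _ ((dl - p) / 2)%C). intros z. rewrite Hf. ring.
- exact Hf.
Qed.

(* w'/(1 + w) is the logarithmic derivative of (1 - al z)(1 - be z)/(1 + x u z), so
   psi_AP (w z) solves y' = R y with R = w' + (1/2) w'/(1 + w). *)
Lemma psi_AP_blaschke_ps (x : R) (u : C) : 0 <= x <= 1 -> Cmod u = 1 ->
  exists c y, is_ps c y /\ forall z, unit_disk z -> psi_AP (blaschke x u z) = y z.
Proof.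
intros Hx Hu. destruct (ps_blaschke x u Hx Hu) as [b [Hb [b0 _]]].
destruct (one_plus_blaschke_factor x u Hx Hu) as [al [be [Hal [Hbe Hf]]]].
destruct (ps_derived _ _ Hb) as [w' [Hw' Tw]].
assert (Hc : Cmod (- (x * u)) <= 1)
  by (rewrite Cmod_opp, Cmod_mult, Hu, Cmod_R, Rabs_pos_eq; lra).
(* R is w' plus half the partial fractions of w'/(1 + w), each of them a geometric series. *)
assert (HR := ps_plus _ _ _ _ Hw' (ps_plus _ _ _ _ (ps_scal (- al / 2) _ _ (ps_geometric al Hal))
  (ps_plus _ _ _ _ (ps_scal (- be / 2) _ _ (ps_geometric be Hbe))
     (ps_scal (- (x * u) / 2) _ _ (ps_geometric _ Hc))))).
destruct (ode_solution _ _ HR) as [c [y [Hy [_ [_ [_ Huniq]]]]]].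
exists c, y. split; [exact Hy|].
apply Huniq.
- rewrite (ps_value_0 _ _ Hb), b0. exact (taylor2_value _ _ _ _ _ taylor2_psi_AP_0).
- intros z Hz. destruct (Tw z Hz) as [D T].
  assert (Hwz : unit_disk (blaschke x u z)).
  { unfold unit_disk in *. assert (X := blaschke_le x u z Hx Hu Hz). lra. }
  assert (X := taylor2_comp _ _ _ _ _ _ _ _ _ T (taylor2_psi_AP _ Hwz)).
  eexists.
  match goal with |- taylor2 _ _ _ ?B _ =>
    replace B with (psi_AP (blaschke x u z) * (1 + / (2 * (1 + blaschke x u z))) * w' z)%C end;
    [exact X|].
  assert (N := blaschke_denominator_neq_0 x u z Hx Hu Hz).
  assert (Na := one_minus_neq_0 al z Hal Hz). assert (Nb := one_minus_neq_0 be z Hbe Hz).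
  set (Q := (1 + x * (1 + u) * z + u * z ^ 2)%C).
  assert (EQ : Q = ((1 - al * z) * (1 - be * z))%C) by apply Hf.
  assert (NQ : Q <> 0) by (rewrite EQ; now apply Cmult_neq_0).
  assert (E1 : (1 + blaschke x u z)%C = (Q / (1 + x * u * z))%C).
  { unfold blaschke, Q. field. exact N. }
  (* The quotient rule for 1 + w = Q/(1 + x u z); w' is known only through its series, so uniqueness
     of expansions links the two. *)
  assert (Ew : w' z = ((x * (1 + u) + 2 * u * z) / (1 + x * u * z)
     - x * u * Q / (1 + x * u * z) ^ 2)%C).
  { assert (T1 : taylor2 (fun v => 1 + x * u * v)%C z (1 + x * u * z) (x * u) 0).
    { exists (fun _ => RtoC 0). split; [lb|]. intros h. ring. }
    assert (T2 : taylor2 (fun v => v * (x + u * v))%C z (z * (x + u * z)) (x + 2 * u * z) u).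
    { exists (fun _ => RtoC 0). split; [lb|]. intros h. ring. }
    assert (T3 := taylor2_mult _ _ _ _ _ _ _ _ _ T2 (taylor2_Cinv _ _ _ _ _ T1 N)).
    rewrite (proj1 (taylor2_unique _ _ _ _ _ _ _ _ T T3)). unfold Q. field. exact N. }
  assert (ED : (x * (1 + u) + 2 * u * z)%C = (- al * (1 - be * z) - be * (1 - al * z))%C).
  (* Evaluating the factorisation at 1 and -1 recovers x(1 + u) = -al - be and u = al be. *)
  { assert (F1 := Hf 1). assert (F2 := Hf (- (1))%C).
    assert (S1 : (x * (1 + u))%C = (- al - be)%C).
    { transitivity (((1 + x * (1 + u) * 1 + u * 1 ^ 2)
        - (1 + x * (1 + u) * - (1) + u * (- (1)) ^ 2)) / 2)%C; [field|].
      rewrite F1, F2. field. }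
    assert (S2 : u = (al * be)%C).
    { transitivity ((1 + x * (1 + u) * 1 + u * 1 ^ 2) - 1 - x * (1 + u))%C; [ring|].
      rewrite F1, S1. ring. }
    rewrite S1. rewrite S2 at 1. ring. }
  rewrite E1.
  assert (EL : (w' z / (Q / (1 + x * u * z)))%C
    = (- al / (1 - al * z) - be / (1 - be * z) - x * u / (1 + x * u * z))%C).
  { rewrite Ew, ED, EQ. field. repeat split; assumption. }
  transitivity (psi_AP (blaschke x u z) * (w' z + / 2 * (w' z / (Q / (1 + x * u * z)))))%C.
  + field. repeat split; assumption.
  + rewrite EL. replace (1 - - (x * u) * z)%C with (1 + x * u * z)%C by ring.
    field. repeat split; assumption.
Qed.

(** With y = psi_AP(w) and Q = (y - 1)/z, let g' = Q g and f = z g. Then z f'/f = 1 + z Q = y. *)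
Lemma blaschke_extremal (x : R) (u : C) : 0 <= x <= 1 -> Cmod u = 1 ->
  exists f a, class_S_AP f /\ has_coefficients f a /\
    a 2%nat = (RtoC (3 / 2) * x)%C /\
    a 3%nat = (RtoC (3 / 4) * (u * (1 - x ^ 2)) + RtoC (25 / 16) * x ^ 2)%C.
Proof.
intros Hx Hu. destruct (ps_blaschke x u Hx Hu) as [b [Hb [b0 [b1 b2]]]].
assert (Hwd : forall z, unit_disk z -> unit_disk (blaschke x u z)).
{ intros z Hz. assert (X := blaschke_le x u z Hx Hu Hz). unfold unit_disk in *. lra. }
destruct (psi_AP_blaschke_ps x u Hx Hu) as [c [y [Hy Ey]]].
assert (Hw0 : blaschke x u 0 = 0) by (rewrite (ps_value_0 _ _ Hb); exact b0).
assert (Hy0 : y 0 = 1).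
{ rewrite <- Ey, Hw0 by exact unit_disk_0. exact (taylor2_value _ _ _ _ _ taylor2_psi_AP_0). }
destruct (ps_divide _ _ 0 Hy unit_disk_0) as [c' [Q [HQ [EQ _]]]].
destruct (ode_solution _ _ HQ) as [e [g [Hg [e0 [Ng [Tg _]]]]]].
pose (f := fun v : C => (v * g v)%C).
assert (Df : forall z, unit_disk z -> is_derive (K := C_AbsRing) (V := C_NormedModule)
   f z (g z * y z)%C).
{ intros z Hz. destruct (Tg z Hz) as [D T].
  assert (X := taylor2_mult _ _ _ _ _ _ _ _ _ (taylor2_id z) T).
  replace (g z * y z)%C with (z * (Q z * g z) + 1 * g z)%C.
  - exact (is_derive_taylor2 _ _ _ _ _ X).
  - rewrite (EQ z Hz), Hy0. ring. }
(* Multiplication by z moves the coefficients of g up by one index. *)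
assert (Ha : has_coefficients f (fun n => e (pred n))).
{ intros z Hz. assert (X := csum_scal z _ _ (csum_shift _ _ (proj2 Hg z Hz))).
  cbv beta in X. rewrite e0 in X.
  change (csum (fun n => e (pred (n + 2)) * z ^ (n + 2))%C (z * g z - z)%C).
  replace (z * g z - z)%C with (z * (g z - 1 * z ^ 0))%C by (simpl; ring).
  eapply csum_ext; [|exact X]. intros n. rewrite Nat.add_comm. simpl. ring. }
assert (Eq : forall z, unit_disk z ->
  starlike_quotient f z = psi_AP (blaschke x u z)).
{ intros z Hz. unfold starlike_quotient. destruct (Ceq_dec z 0) as [->|N].
  - rewrite Ey, Hy0 by exact Hz. reflexivity.
  - rewrite (is_C_derive_unique _ _ _ (Df z Hz)), Ey by exact Hz. unfold f. field.
    split; [now apply Ng | exact N]. }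
exists f, (fun n => e (pred n)).
split; [|split; [exact Ha|]].
- split.
  + split; [intros z Hz; eexists; now apply Df|]. split; [unfold f; ring|].
    rewrite (is_C_derive_unique _ _ _ (Df 0 unit_disk_0)), Hy0, (ps_value_0 _ _ Hg), e0. ring.
  + exists (blaschke x u). split; [|exact Eq]. split; [|split; [exact Hw0 | exact Hwd]].
    intros z Hz. destruct (ps_taylor2 _ _ z Hb Hz) as [B [D T]].
    eexists. exact (is_derive_taylor2 _ _ _ _ _ T).
- apply (starlike_coefficients _ (blaschke x u) _ _ _ Ha Hwd Eq).
  assert (T := ps_taylor2_0 _ _ Hb). rewrite b0, b1, b2 in T. exact T.
Qed.

Theorem theorem6p2 (lambda : C) (mu : R) (hmu : 0 < mu) :
  (forall (f : C -> C) (a : nat -> C),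
      class_S_AP f -> has_coefficients f a ->
      F_functional lambda mu a >= B_AP lambda mu)
  /\
  (exists (f : C -> C) (a : nat -> C),
      class_S_AP f /\ has_coefficients f a /\
      F_functional lambda mu a = B_AP lambda mu).
Proof.
split.
- intros f a Hf Ha. apply Rle_ge. now apply (F_functional_lower_bound lambda mu f a).
- destruct (B_AP_attained lambda mu hmu) as [x [Hx E]].
  set (nu := (lambda - RtoC (25 / 36))%C) in *.
  (* Taking u as the direction of nu aligns c2 = u(1 - x^2) with nu c1^2, giving equality in the
     reverse triangle inequality or, in the middle case, the value 0. For nu = 0 the direction 1 is
     chosen. *)
  assert (Hu : exists u, Cmod u = 1 /\ nu = (Cmod nu * u)%C).
  { destruct (Ceq_dec nu 0) as [->|N].
    - exists (RtoC 1). rewrite Cmod_1, Cmod_0. split; [reflexivity | ring].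
    - assert (P := proj1 (Cmod_gt_0 nu) N).
      assert (N' : RtoC (Cmod nu) <> 0) by (intros E'; apply RtoC_inj in E'; lra).
      exists (nu / Cmod nu)%C. split; [|field; exact N'].
      rewrite Cmod_div, Cmod_R, Rabs_pos_eq by (exact N' || lra). field. lra. }
  destruct Hu as [u [Hu Enu]].
  destruct (blaschke_extremal x u Hx Hu) as [f [a [Hf [Ha [E2 E3]]]]].
  exists f, a. split; [exact Hf|]. split; [exact Ha|].
  rewrite (F_functional_eq lambda mu a _ _ E2 E3). fold nu. rewrite <- E.
  rewrite Cmod_R, (Rabs_pos_eq x) by lra. f_equal.
  replace (RtoC (3 / 4) * (u * (1 - x ^ 2)) - RtoC (9 / 4) * nu * x ^ 2)%C
    with (u * RtoC (3 / 4 * (1 - x ^ 2) - 9 / 4 * Cmod nu * x ^ 2))%C.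
  + rewrite Cmod_mult, Hu, Cmod_R. ring.
  + rewrite Enu at 2. rewrite RtoC_minus, !RtoC_mult, RtoC_minus, RtoC_pow. ring.
Qed.
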